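(* Let $f:\mathbb{R}\to\mathbb{R}$ be convex. Let $u_0\in L^\infty(\mathbb{R})$, put $v_0(x)=\int_0^x u_0(\theta)\,d\theta$, and let $\tilde f$ be an $R$-modification of $f$ with $R=\|u_0\|_\infty$ (see context; if $f$ is itself super-linear one may take $\tilde f=f$). Let $V(x,t)$ and $V(x,s,t)$ be the value functions associated with $\tilde f$ and $v_0$ as in the context. Then: 1. $V$ is a Lipschitz function on $\mathbb{R}\times[0,\infty)$, and for all $x,y\in\mathbb{R}$ and $t>0$, $|V(x,t)-V(y,t)|\le \mathrm{Lip}(v_0)\,|x-y|$. 2. (Dynamic programming principle) $V(x,s,t)=V(x,t)$ for all $x\in\mathbb{R}$ and $0\le s<t$. 3. $V$ is a viscosity solution of $V_t+f(V_x)=0$ for $x\in\mathbb{R}$, $t>0$, with $V(x,0)=v_0(x)$ for $x\in\mathbb{R}$. 4. The function $u(x,t):=\frac{\partial}{\partial x}V(x,t)$ (defined almost everywhere) is a weak solution of $u_t+f(u)_x=0$, $u(\cdot,0)=u_0$, and $\|u\|_\infty\le\|u_0\|_\infty$. 5. ($L^1$ contractivity) Let $u_{10},u_{20}\in L^\infty(\mathbb{R})$, let $\tilde f$ be an $R$-modification of $f$ with $R=\max(\|u_{10}\|_\infty,\|u_{20}\|_\infty)$, and for $i=1,2$ let $u_i=\frac{\partial V_i}{\partial x}$, where $V_i$ is the value function associated with $\tilde f$ and $v_{i0}(x)=\int_0^x u_{i0}(\theta)\,d\theta$. Set $$L:=\lim_{\epsilon\to0^+}\operatorname{ess\,sup}\{|f'(p)|:p\in[-R-\epsilon,R+\epsilon]\}.$$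 Then for a.e. $t>0$ and for all $a<b$, $$\int_a^b|u_1(x,t)-u_2(x,t)|\,dx\le\int_{a-Lt}^{b+Lt}|u_{10}(x)-u_{20}(x)|\,dx.$$
   Context: A function $g:\mathbb{R}\to\mathbb{R}$ is super-linear if $\lim_{|p|\to\infty}g(p)/|p|=\infty$. For $R\ge0$, an $R$-modification of a convex function $f$ is a convex super-linear function $\tilde f:\mathbb{R}\to\mathbb{R}$ with $\tilde f(p)=f(p)$ for all $p\in[-R-1,R+1]$ (such a function always exists). Fenchel dual: $\tilde f^*(q)=\sup_{p\in\mathbb{R}}\{pq-\tilde f(p)\}$, which is finite for every $q$. Value functions associated with a convex super-linear flux $\tilde f$ and a Lipschitz function $v_0$: $V(x,0)=v_0(x)$; for $t>0$, $V(x,t)=\inf_{y\in\mathbb{R}}\{v_0(y)+t\tilde f^*(\frac{x-y}{t})\}$; for $0\le s<t$, $V(x,s,t)=\inf_{y\in\mathbb{R}}\{V(y,s)+(t-s)\tilde f^*(\frac{x-y}{t-s})\}$. $\mathrm{Lip}(v_0)$ denotes the Lipschitz constant of $v_0$ (one has $\mathrm{Lip}(v_0)\le\|u_0\|_\infty$). For $u_0\in L^\infty(\mathbb{R})$, a function $u\in L^\infty(\mathbb{R}\times(0,\infty))$ is a weak solution of $u_t+f(u)_x=0$, $u(\cdot,0)=u_0$, if $$\int_0^\infty\int_{-\infty}^\infty(u\varphi_t+f(u)\varphi_x)\,dx\,dt+\int_{-\infty}^\infty u_0(x)\varphi(x,0)\,dx=0\quad\text{for all }\varphi\in C_c^\infty(\mathbb{R}\times[0,\infty)).$$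 *)

(* Defs.v *)
From HB Require Import structures.
From mathcomp Require Import all_boot all_order all_algebra.
From mathcomp Require Import all_classical all_reals all_analysis.
From mathcomp Require Import ess_sup_inf.

Set Implicit Arguments.
Unset Strict Implicit.
Unset Printing Implicit Defensive.

Import Order.TTheory GRing.Theory Num.Theory.
Import numFieldNormedType.Exports.

Local Open Scope classical_set_scope.
Local Open Scope ring_scope.

Section Flux.
Context {R : realType}.
Implicit Types (f g v : R -> R) (r q x s t : R).

Definition superlinear g : Prop :=
  (g p / `|p| @[p --> +oo] --> +oo) /\ (g p / `|p| @[p --> -oo] --> +oo).

Definition modification f r (g : R -> R) : Prop :=
  [/\ convex_function [set: R] g, superlinear g &
      {in `[- r - 1, r + 1], g =1 f}].

(* [sup] and [inf] take the default value 0 on sets that are empty or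
   unbounded; this never happens for a convex super-linear flux and a Lipschitz
   initial datum, where all the sets below are nonempty and bounded. *)
Definition fenchel g q : R := sup [set p * q - g p | p in [set: R]].

(* Only [0 <= t] is meaningful. *)
Definition value g v x t : R :=
  if 0 < t then inf [set v y + t * fenchel g ((x - y) / t) | y in [set: R]]
  else v x.

Definition value_from g v x s t : R :=
  inf [set value g v y s + (t - s) * fenchel g ((x - y) / (t - s))
      | y in [set: R]].

(* The library derivative is total: it takes an unspecified constant value at
   the points where [value g v ^~ t] is not derivable. *)
Definition dx_value g v x t : R := derive1 (value g v ^~ t) x.

Definition Lip v : \bar R :=
  ereal_sup [set e | exists x y, x != y /\
                     e = (`|v x - v y| / `|x - y|)%:E].

End Flux.

Section Linfty.
Context {R : realType}.
Local Notation mu := (@lebesgue_measure R).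

Definition Linfty_norm (u0 : R -> R) : \bar R := 'N[mu]_+oo[EFin \o u0]%E.

Definition primitive (u0 : R -> R) (x : R) : R :=
  if 0 <= x then \int[mu]_(theta in `[0, x]) u0 theta
  else - \int[mu]_(theta in `[x, 0]) u0 theta.

Definition open_half : set (R * R) := [set: R] `*` [set` `]0, +oo[].
Definition closed_half : set (R * R) := [set: R] `*` [set` `[0, +oo[].

Lemma measurable_open_half :
  measurable (open_half : set (measurableTypeR R * measurableTypeR R)).
Proof. exact: measurableX. Qed.

Definition half_measure := mrestr (mu \x mu)%E measurable_open_half.

Definition half_norm (u : R -> R -> R) : \bar R :=
  'N[half_measure]_+oo[(fun z => (u z.1 z.2)%:E)]%E.

Definition Linfty_half (u : R -> R -> R) : Prop :=
  measurable_fun (open_half : set (measurableTypeR R * measurableTypeR R))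
    (fun z => u z.1 z.2) /\ (half_norm u < +oo)%E.

(* [lim_{e -> 0+} ess sup_{p in [-r-e, r+e]} |f'(p)|]; for a convex [f] the
   points of non-derivability form a null set, the limit exists by monotonicity
   in [e] and is finite. *)
Definition max_speed (f : R -> R) (r : R) : R :=
  fine (lim (ess_sup (mrestr mu (measurable_itv `[- r - e, r + e]))
               (fun p => `|derive1 f p|%:E) @[e --> 0^'+])).

End Linfty.

Section Solutions.
Context {R : realType}.
Local Notation mu := (@lebesgue_measure R).

Definition Dx (phi : R * R -> R) : R * R -> R := 'D_(1, 0) phi.
Definition Dt (phi : R * R -> R) : R * R -> R := 'D_(0, 1) phi.

(* [U] is meant to be open. *)
Fixpoint Ck (U : set (R * R)) (k : nat) (phi : R * R -> R) : Prop :=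
  (forall z, U z -> {for z, continuous phi}) /\
  if k is k'.+1 then
    [/\ forall z, U z -> derivable phi z (1, 0) /\ derivable phi z (0, 1),
        Ck U k' (Dx phi) & Ck U k' (Dt phi)]
  else True.

(* Elements of [C_c^oo(R x [0, oo[)] are represented by (all) their extensions
   to elements of [C_c^oo(R x R)]. *)
Definition test_function (phi : R * R -> R) : Prop :=
  (forall k, Ck setT k phi) /\ compact (closure [set z | phi z != 0]).

Definition weak_solution (f u0 : R -> R) (u : R -> R -> R) : Prop :=
  Linfty_half u /\
  forall phi, test_function phi ->
    \int[mu]_(t in `]0, +oo[)
       (\int[mu]_x (u x t * Dt phi (x, t) + f (u x t) * Dx phi (x, t)))
    + \int[mu]_x (u0 x * phi (x, 0)) = 0.

(* Crandall-Lions continuous viscosity solutions, with C^1 test functions. *)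
Definition viscosity_solution (f v0 : R -> R) (V : R -> R -> R) : Prop :=
  [/\ {within closed_half, continuous (fun z : R * R => V z.1 z.2)},
      forall x, V x 0 = v0 x,
      forall (phi : R * R -> R) (z0 : R * R), Ck open_half 1 phi ->
        open_half z0 ->
        (\forall z \near z0, V z.1 z.2 - phi z <= V z0.1 z0.2 - phi z0) ->
        Dt phi z0 + f (Dx phi z0) <= 0 &
      forall (phi : R * R -> R) (z0 : R * R), Ck open_half 1 phi ->
        open_half z0 ->
        (\forall z \near z0, V z0.1 z0.2 - phi z0 <= V z.1 z.2 - phi z) ->
        0 <= Dt phi z0 + f (Dx phi z0)].

End Solutions.

(* Main.v *)
Require Import Defs.
From HB Require Import structures.
From mathcomp Require Import all_boot all_order all_algebra.
From mathcomp Require Import all_classical all_reals all_analysis.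
From mathcomp Require Import ess_sup_inf measurable_realfun ring lra.

Set Implicit Arguments.
Unset Strict Implicit.
Unset Printing Implicit Defensive.

Import Order.TTheory GRing.Theory Num.Theory.
Import numFieldNormedType.Exports.

Local Open Scope classical_set_scope.
Local Open Scope ring_scope.

(** Write [V t] for the Hopf-Lax evolution of [v0]. As [v0] is [r]-Lipschitz, the
    infimum is attained at some [q] in [-L, L], where [L] bounds the slopes of the
    flux on [-r, r]; with the convexity of the conjugate this gives the Lipschitz
    bounds and the semigroup property, and the viscosity inequalities follow from
    first order expansions of the test function.

    Wherever [V t] is derivable in [x], the semigroup property gives the right time
    derivative [- f (V_x)]. Hence [t |-> int V phi_x dx] is Lipschitz with right
    derivative [- int (u phi_t + f(u) phi_x) dx] at every [t], and integrating it in
    time gives the weak formulation. Lipschitz functions of one variable are the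
    integrals of their derivatives by Radon-Nikodym and Lebesgue differentiation.

    For the contraction let [y1], [y2] be monotone selections of minimizers for two
    data, [w] the difference of the data, [W] that of the solutions, and [G] a
    primitive of [|u10 - u20|]. Since exchanging crossing minimizers costs nothing,
    [Phi = min (G y1 - w y1 + W) (G y2 + w y2 - W)] controls the increments of [W],
    and [G (x - L t) <= Phi x <= G (x + L t)]. *)

(** * Convex functions and conjugates *)

(** The flux [f] enters only through slopes bounded by [r]: each [V t] is [r]-Lipschitz, so where a
    test function touches [V], or where [V t] is derivable, the slope lies in [-r, r], and there the
    modification agrees with [f]. The unit of slack in the modification is spent on the propagation
    speed alone: a subgradient at the end point [r] may exceed every derivative of [f] inside
    [-r, r], but not those just beyond [r], whence the limit over shrinking enlargements in [L].

    Differentiability is used in [x] at one time, or in [t] for one moment, so no planar Rademacher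
    theorem is needed. What remains in two variables is measurability, and for this derivability is
    tested along sequences. A right time derivative suffices because the moment is Lipschitz, hence
    derivable at almost every time.

    The contraction uses neither entropies nor doubling of variables. [Phi] is only monotone and may
    jump; a Lipschitz function squeezed below it turns its increments into an integral. *)

Section Convex.
Context {R : realType}.
Implicit Types (g : R -> R) (p q x y z s t L : R).

(** The chord inequality multiplied by [z - x]: no quotients, and degenerate triples are allowed, so
    it feeds linear arithmetic directly. *)
Definition convexR g := forall x y z, x <= y -> y <= z ->
  (z - x) * g y <= (z - y) * g x + (y - x) * g z.

Definition subgrad g p q := forall x, g p + q * (x - p) <= g x.

Lemma convex_functionR g : convex_function [set: R] g -> convexR g.
Proof.
move=> gc x y z xy yz.
have [xz|xz] := eqVneq x z.
  have -> : y = x by apply/eqP; rewrite eq_le xy xz yz.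
  by rewrite xz !subrr !mul0r addr0.
have {}xz : 0 < z - x by rewrite subr_gt0 lt_neqAle xz (le_trans xy yz).
have t0 : 0 <= (z - y) / (z - x) by rewrite divr_ge0 ?subr_ge0// (le_trans xy).
have t1 : (z - y) / (z - x) <= 1 by rewrite ler_pdivrMr//; lra.
have := gc (Itv01 t0 t1) x z; rewrite !inE => /(_ I I).
rewrite [X in g X <= _](_ : _ = y); last first.
  transitivity ((z - y) / (z - x) * x + (1 - (z - y) / (z - x)) * z) => //.
  by field; rewrite gt_eqF.
rewrite convRE /= /unstable.onem.
rewrite -(ler_pM2l xz) => /le_trans; apply.
rewrite le_eqVlt; apply/orP; left; apply/eqP; field; rewrite gt_eqF//.
Qed.

Lemma subgrad_mono g p q p' q' :
  subgrad g p q -> subgrad g p' q' -> p < p' -> q <= q'.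
Proof.
move=> /(_ p') h1 /(_ p) h2 pp'.
rewrite -(@ler_pM2r _ (p' - p)) ?subr_gt0//; lra.
Qed.

(** The left derivative works: slopes of chords ending at [p] are bounded by every slope of a chord
    starting at [p], and their supremum separates the two families. *)
Lemma subgrad_exists g p : convexR g -> exists q, subgrad g p q.
Proof.
move=> gc; pose S := [set (g p - g x) / (p - x) | x in [set x | x < p]].
have ubS y : p < y -> ubound S ((g y - g p) / (y - p)).
  move=> py _ [x /= xp <-]; rewrite ler_pdivrMr ?subr_gt0//.
  rewrite mulrAC ler_pdivlMr ?subr_gt0//.
  have := gc x p y (ltW xp) (ltW py); lra.
have S0 : S !=set0 by exists ((g p - g (p - 1)) / (p - (p - 1))), (p - 1) => //=; lra.
have hS : has_sup S.
  split=> //; exists ((g (p + 1) - g p) / (p + 1 - p)); apply: ubS; lra.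
exists (sup S) => x; have [xp|px|->] := ltgtP x p; last by rewrite subrr mulr0 addr0.
- have : (g p - g x) / (p - x) <= sup S by apply: (ub_le_sup hS.2); exists x.
  rewrite ler_pdivrMr ?subr_gt0//; lra.
- have : sup S <= (g x - g p) / (x - p) by apply: ge_sup => //; exact: ubS.
  rewrite ler_pdivlMr ?subr_gt0//; lra.
Qed.

Lemma subgrad_right g p q x y : convexR g -> subgrad g p q -> p <= x -> x <= y ->
  g x + q * (y - x) <= g y.
Proof.
move=> gc gpq; rewrite le_eqVlt => /predU1P[<-//|px] xy.
have := gc p x y (ltW px) xy; have := gpq x.
move=> h1 h2; have h3 : (y - x) * (g p + q * (x - p)) <= (y - x) * g x.
  by rewrite ler_wpM2l ?subr_ge0.
rewrite -(@ler_pM2l _ (x - p)) ?subr_gt0//; lra.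
Qed.

(** Subgradients are monotone, so all slopes at points of [-M, M] lie between one chosen at
    [- M - 1] and one chosen at [M + 1]. *)
Lemma convex_locally_lipschitz g M : convexR g ->
  exists2 K, 0 <= K & forall x y, -M <= x <= M -> -M <= y <= M ->
    `|g x - g y| <= K * `|x - y|.
Proof.
move=> gc; have [a ga] := subgrad_exists (- M - 1) gc.
have [b gb] := subgrad_exists (M + 1) gc.
pose K := `|a| + `|b|.
have sK x q : -M <= x <= M -> subgrad g x q -> `|q| <= K.
  move=> xM gq; have := subgrad_mono ga gq; have := subgrad_mono gq gb.
  move=> /(_ ltac:(lra)) qb /(_ ltac:(lra)) aq; rewrite /K ler_norml.
  have := ler_norm b; have := ler_norm (- a); rewrite normrN.
  have := normr_ge0 a; have := normr_ge0 b; lra.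
have oneside x y : -M <= x <= M -> g x - g y <= K * `|x - y|.
  move=> xM; have [q gq] := subgrad_exists x gc.
  have := gq y; have := sK _ _ xM gq => qK h.
  apply: (@le_trans _ _ (`|q| * `|x - y|)); last exact: ler_wpM2r.
  by rewrite -normrM; apply: le_trans (ler_norm _); lra.
exists K; first by rewrite addr_ge0.
move=> x y xM yM; rewrite ler_norml oneside// andbT lerNl opprB distrC.
exact: oneside.
Qed.

Lemma convex_continuous g : convexR g -> continuous g.
Proof.
move=> gc x; have [K K0 gK] := convex_locally_lipschitz (`|x| + 1) gc.
apply/cvgrPdist_le => e e0.
have d0 : 0 < Num.min 1 (e / (K + 1)).
  by rewrite lt_min ltr01 divr_gt0// ltr_wpDl.
exists (Num.min 1 (e / (K + 1))) => //= y /=; rewrite lt_min => /andP[xy1 xy].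
apply: (le_trans (gK _ _ _ _)); rewrite -?ler_norml ?lerDl//.
  by rewrite -[y](subrK x) addrC (le_trans (ler_normD _ _))// lerD2l distrC ltW.
rewrite (le_trans (ler_wpM2l K0 (ltW xy)))// mulrA ler_pdivrMr ?ltr_wpDl//.
by rewrite mulrC ler_pM2l// lerDl.
Qed.

Lemma subgradN g p q : subgrad g p q -> subgrad (g \o -%R) (- p) (- q).
Proof. by move=> gpq x /=; rewrite opprK; have := gpq (- x); lra. Qed.

Lemma convexRN g : convexR g -> convexR (g \o -%R).
Proof.
move=> gc x y z xy yz /=; have := gc (- z) (- y) (- x).
by rewrite !lerN2 => /(_ yz xy); lra.
Qed.

(** The inner points [a + d] and [b] have the same sum as the outer points [a] and [b + d], so the
    two convexity inequalities carry complementary weights and can be added. This is what makes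
    exchanging crossing minimizers free. *)
Lemma convex_uncross g a b d : convexR g -> a <= b -> 0 <= d ->
  g (a + d) + g b <= g a + g (b + d).
Proof.
move=> gc ab d0; have [e|ne] := eqVneq (b + d) a.
  have d00 : d = 0 by lra.
  by rewrite d00 !addr0 addrC.
have abd : 0 < b + d - a by rewrite subr_gt0 lt_neqAle eq_sym ne; lra.
have h1 := gc a (a + d) (b + d) ltac:(lra) ltac:(lra).
have h2 := gc a b (b + d) ltac:(lra) ltac:(lra).
rewrite -(ler_pM2l abd); lra.
Qed.

(** Beyond [M], superlinearity at threshold [|q|] makes [p * q - g p] nonpositive; on [-M, M] a
    support line of [g] at 0 bounds it. *)
Lemma superlinear_has_sup g q : convexR g -> superlinear g ->
  has_sup [set p * q - g p | p in [set: R]].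
Proof.
move=> gc [/cvgryPge gy /cvgryPge gNy].
split; first by exists (0 * q - g 0), 0.
have [s gs] := subgrad_exists 0 gc.
have [[M1 [_ M1P]] [M2 [_ M2P]]] := (gy `|q|, gNy `|q|).
pose M := Num.max 1 (Num.max (M1 + 1) (1 - M2)).
exists (M * (`|q| + `|s|) + `|g 0|) => _ [p _ <-].
have M0 : 0 <= M by rewrite le_max ler01.
have [pM|Mp] := lerP `|p| M.
  have := gs p; rewrite subr0 => gp.
  have : p * (q - s) <= M * (`|q| + `|s|).
    rewrite (le_trans (ler_norm _))// normrM ler_pM// (le_trans (ler_normB _ _))//.
  have := ler_norm (- g 0); rewrite normrN; lra.
have : `|q| <= g p / `|p|.
  move: Mp; rewrite /M !gt_max => /and3P[p1 pM1 pM2].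
  have [p0|p0] := leP 0 p.
    by apply: M1P; move: pM1; rewrite ger0_norm//; lra.
  by apply: M2P; move: pM2; rewrite ltr0_norm//; lra.
have p0 : 0 < `|p| by rewrite (lt_le_trans ltr01)// ltW// (le_lt_trans _ Mp)// le_max lexx.
rewrite ler_pdivlMr// => gq; have := ler_norm (p * q); rewrite normrM mulrC => pq.
have : 0 <= M * (`|q| + `|s|) + `|g 0| by rewrite addr_ge0// mulr_ge0// addr_ge0.
by lra.
Qed.

(* Replaces superlinearity: all that is used of it is that the conjugate is
   finite. *)
Definition finite_conjugate g :=
  forall q, has_sup [set p * q - g p | p in [set: R]].

Section Conjugate.
Variable g : R -> R.
Hypotheses (gc : convexR g) (gs : finite_conjugate g).

Lemma fenchel_young p q : p * q <= g p + fenchel g q.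
Proof.
have : p * q - g p <= fenchel g q by apply: (ub_le_sup (gs q).2); exists p.
lra.
Qed.

Lemma fenchel_subgrad p q : subgrad g p q -> fenchel g q = p * q - g p.
Proof.
move=> gpq; apply/eqP; rewrite eq_le; apply/andP; split.
  apply: ge_sup; first exact: (gs q).1.
  by move=> _ [x _ <-]; have := gpq x; lra.
by have := fenchel_young p q; lra.
Qed.

Lemma subgrad_fenchel p q : subgrad g p q -> subgrad (fenchel g) q p.
Proof.
by move=> gpq s; rewrite (fenchel_subgrad gpq); have := fenchel_young p s; lra.
Qed.

Lemma fenchel_convex : convexR (fenchel g).
Proof.
move=> x y z xy yz; have [xz|] := ltP x z; last first.
  move=> zx; have -> : y = x by apply/eqP; rewrite eq_le xy (le_trans yz).
  have -> : z = x by apply/eqP; rewrite eq_le zx (le_trans xy).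
  by rewrite subrr !mul0r addr0.
rewrite mulrC -ler_pdivlMr ?subr_gt0//; apply: ge_sup; first exact: (gs y).1.
move=> _ [p _ <-]; rewrite ler_pdivlMr ?subr_gt0//.
have h1 : (z - y) * (p * x - g p) <= (z - y) * fenchel g x.
  by rewrite ler_wpM2l ?subr_ge0//; have := fenchel_young p x; lra.
have h2 : (y - x) * (p * z - g p) <= (y - x) * fenchel g z.
  by rewrite ler_wpM2l ?subr_ge0//; have := fenchel_young p z; lra.
lra.
Qed.

End Conjugate.

(** For a differentiable flux this is [|g'| <= L] on [-r, r]; subgradients also cover corners, where
    a whole interval of speeds occurs. *)
Definition speed_bound g r L :=
  forall p q, - r <= p <= r -> subgrad g p q -> - L <= q <= L.

(** A subgradient [s] of [g] at [r] satisfies [s <= L], and by duality [r] is a subgradient of the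
    conjugate at [s]. Beyond [L] the conjugate thus grows at least as fast as an [r]-Lipschitz datum
    can decrease. *)
Lemma fenchel_above g r L q : convexR g -> finite_conjugate g -> 0 <= r ->
  speed_bound g r L -> L <= q -> fenchel g L + r * (q - L) <= fenchel g q.
Proof.
move=> gc gs r0 gL Lq; have [s gs'] := subgrad_exists r gc.
apply: (subgrad_right (fenchel_convex gs) (subgrad_fenchel gs gs')) => //.
by have /andP[] := gL r s ltac:(lra) gs'.
Qed.

(** The reflection [p -> - p] also reflects the conjugate; it reduces [fenchel_below] to
    [fenchel_above]. *)
Lemma finite_conjugateN g : finite_conjugate g -> finite_conjugate (g \o -%R).
Proof.
move=> gs q; suff -> : [set p * q - (g \o -%R) p | p in [set: R]] =
  [set p * (- q) - g p | p in [set: R]] by exact: gs.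
apply/seteqP; split=> _ [p _ <-]; exists (- p) => //=; rewrite ?opprK; lra.
Qed.

Lemma fenchelN g q : fenchel (g \o -%R) q = fenchel g (- q).
Proof.
congr sup; apply/seteqP; split=> _ [p _ <-]; exists (- p) => //=; rewrite ?opprK; lra.
Qed.

Lemma speed_boundN g r L : speed_bound g r L -> speed_bound (g \o -%R) r L.
Proof.
move=> gL p q pr /subgradN gq; have := gL (- p) (- q) ltac:(lra).
rewrite (_ : (g \o -%R) \o -%R = g) in gq; last by apply/funext => x /=; rewrite opprK.
by move=> /(_ gq); lra.
Qed.

Lemma fenchel_below g r L q : convexR g -> finite_conjugate g -> 0 <= r ->
  speed_bound g r L -> q <= - L -> fenchel g (- L) + r * (- L - q) <= fenchel g q.
Proof.
move=> gc gs r0 gL qL.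
have := @fenchel_above (g \o -%R) r L (- q) (convexRN gc) (finite_conjugateN gs) r0
  (speed_boundN gL).
by rewrite !fenchelN opprK; move=> /(_ ltac:(lra)); lra.
Qed.

Lemma speed_bound_ge0 g r L : convexR g -> 0 <= r -> speed_bound g r L -> 0 <= L.
Proof.
move=> gc r0 gL; have [q gq] := subgrad_exists r gc.
by have := gL r q ltac:(lra) gq; lra.
Qed.

Lemma speed_bound_exists g r : convexR g -> exists L, speed_bound g r L.
Proof.
move=> gc; have [a ga] := subgrad_exists (- r - 1) gc.
have [b gb] := subgrad_exists (r + 1) gc.
exists (`|a| + `|b|) => p q pr gq.
have := subgrad_mono ga gq; have := subgrad_mono gq gb.
move=> /(_ ltac:(lra)) qb /(_ ltac:(lra)) aq.
have := ler_norm b; have := ler_norm (- a); rewrite normrN.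
have := normr_ge0 a; have := normr_ge0 b; lra.
Qed.

End Convex.

(** * The Hopf-Lax formula *)

Section HopfLax.
Context {R : realType}.
Implicit Types (g v : R -> R) (p q x y z s t L k : R).

Definition lip k v := forall x y, `|v x - v y| <= k * `|x - y|.

Lemma lip_continuous k v : lip k v -> continuous v.
Proof.
move=> vk x; apply/cvgrPdist_le => e e0.
have k1 : 0 < `|k| + 1 by rewrite ltr_wpDl.
near=> y; rewrite (le_trans (vk _ _))//.
apply: (@le_trans _ _ ((`|k| + 1) * `|x - y|)).
  by rewrite ler_wpM2r// (le_trans (ler_norm _))// lerDl.
rewrite mulrC -ler_pdivlMr//; near: y; apply: cvgr_dist_le; last exact: divr_gt0.
exact: cvg_id.
Unshelve. all: by end_near. Qed.

Lemma lip_ge0 k v : lip k v -> 0 <= k.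
Proof. by move=> /(_ 1 0); rewrite subr0 normr1 mulr1; exact: le_trans. Qed.

(** Parametrized by the speed [q] instead of the foot [x - t * q]: nothing is divided by [t], so
    [t = 0] is an ordinary case, and optimal speeds stay in one compact interval for all [t]. *)
Definition hopf_lax g v t x := inf [set v (x - t * q) + t * fenchel g q | q in [set: R]].

Lemma value_hopf_lax g v t x : 0 <= t -> value g v x t = hopf_lax g v t x.
Proof.
rewrite /value le_eqVlt => /predU1P[<-|t0]; last first.
  rewrite t0; congr inf; apply/seteqP; split=> _ [y _ <-].
    by exists ((x - y) / t) => //; rewrite mulrC divfK ?gt_eqF// subKr.
  by exists (x - t * y) => //; rewrite subKr mulrAC divff ?mul1r// gt_eqF.
rewrite ltxx /hopf_lax (_ : [set _ | _ in _] = [set v x]) ?inf1//.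
apply/seteqP; split=> [_ [q _ <-]|_ ->] /=; first by rewrite !mul0r subr0 addr0.
by exists 0 => //; rewrite !mul0r subr0 addr0.
Qed.

Lemma value_from_hopf_lax g v s t x : s < t ->
  value_from g v x s t = hopf_lax g (value g v ^~ s) (t - s) x.
Proof.
move=> st; have ts : 0 < t - s by rewrite subr_gt0.
by rewrite -value_hopf_lax ?ltW// /value ts.
Qed.

Section Flux.
Variables (g : R -> R) (r L : R).
Hypotheses (gc : convexR g) (gs : finite_conjugate g) (r0 : 0 <= r)
  (gL : speed_bound g r L).

Let L0 : 0 <= L. Proof. exact: speed_bound_ge0 gc r0 gL. Qed.

Let fc : continuous (fenchel g).
Proof. exact: convex_continuous (fenchel_convex gs). Qed.

Section Datum.
Variable v : R -> R.
Hypothesis vr : lip r v.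

Definition minimizer t x q :=
  forall q', v (x - t * q) + t * fenchel g q <= v (x - t * q') + t * fenchel g q'.

Let cost_continuous t x : continuous (fun q => v (x - t * q) + t * fenchel g q).
Proof.
move=> q; apply: cvgD; last by apply: cvgMr; exact: fc.
apply: continuous_comp; last exact: lip_continuous vr _.
by apply: cvgB; [exact: cvg_cst|apply: cvgMr; exact: cvg_id].
Qed.

(** Moving [q] to the nearest point [q'] of [-L, L] moves the foot by [t * |q - q'|] and raises [v]
    by at most [r] times that; the growth of the conjugate outside [-L, L] pays it back. *)
Lemma clamp_cost t x q : 0 <= t -> exists2 q', - L <= q' <= L &
  v (x - t * q') + t * fenchel g q' <= v (x - t * q) + t * fenchel g q.
Proof.
move=> t0; have L_ge0 := L0.
have vt q1 q2 : v (x - t * q1) <= v (x - t * q2) + t * (r * `|q1 - q2|).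
  have := vr (x - t * q1) (x - t * q2); rewrite ler_norml => /andP[_].
  by rewrite (_ : x - t * q1 - _ = - (t * (q1 - q2))) ?normrN ?normrM ?(ger0_norm t0); lra.
have [qL|Lq] := leP q (- L).
  exists (- L); first lra.
  have := fenchel_below gc gs r0 gL qL; have := vt (- L) q.
  rewrite ger0_norm ?subr_ge0// => h1 h2.
  have := ler_wpM2l t0 h2; lra.
have [qL'|Lq'] := leP L q; last by exists q; lra.
exists L; first lra.
have := fenchel_above gc gs r0 gL qL'; have := vt L q.
rewrite distrC ger0_norm ?subr_ge0// => h1 h2.
have := ler_wpM2l t0 h2; lra.
Qed.

Lemma minimizer_exists t x : 0 <= t -> exists2 q, - L <= q <= L & minimizer t x q.
Proof.
move=> t0; have L_ge0 := L0; have [|q qL qmin] :=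
  @EVT_min R (fun q => v (x - t * q) + t * fenchel g q) (- L) L ltac:(lra).
  by apply: continuous_subspaceT; exact: cost_continuous.
exists q => // q'; have [q'' q''L] := clamp_cost x q' t0.
by apply: le_trans; apply: qmin.
Qed.

Lemma minimizerE t x q : minimizer t x q ->
  hopf_lax g v t x = v (x - t * q) + t * fenchel g q.
Proof.
move=> qmin; apply/eqP; rewrite eq_le; apply/andP; split.
  apply: ge_inf; last by exists q.
  by exists (v (x - t * q) + t * fenchel g q) => _ [q' _ <-].
apply: lb_le_inf; first by exists (v (x - t * q) + t * fenchel g q), q.
by move=> _ [q' _ <-].
Qed.

Lemma hopf_lax_le t x q : 0 <= t ->
  hopf_lax g v t x <= v (x - t * q) + t * fenchel g q.
Proof. by move=> /(minimizer_exists x)[q' _ q'min]; rewrite (minimizerE q'min). Qed.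

Lemma hopf_lax_attained t x : 0 <= t -> exists2 q, - L <= q <= L &
  hopf_lax g v t x = v (x - t * q) + t * fenchel g q.
Proof. by move=> /(minimizer_exists x)[q qL /minimizerE]; exists q. Qed.

(** The optimal speed at [y] is a competitor at [x]: the conjugate terms cancel and the feet differ
    by [x - y]. Keeping [k] apart from [r] lets the exact constant [Lip v] pass to later times. *)
Lemma hopf_lax_lip k t : 0 <= t -> lip k v -> lip k (hopf_lax g v t).
Proof.
move=> t0 vk; have side x y : hopf_lax g v t x - hopf_lax g v t y <= k * `|x - y|.
  have [q _ ->] := hopf_lax_attained y t0.
  have := hopf_lax_le x q t0; have := vk (x - t * q) (y - t * q).
  by rewrite ler_norml (_ : x - t * q - (y - t * q) = x - y); lra.
by move=> x y; rewrite ler_norml side andbT lerNl opprB distrC side.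
Qed.

(** The smallest optimal speed in [-L, L], found by compactness, gives the largest foot. The bound
    on [z] excludes speeds below [- L]; feet of speed above [L] lie to the left anyway. *)
Lemma largest_minimizer_point t x : 0 < t -> exists y,
  [/\ - (L * t) <= x - y <= L * t,
      hopf_lax g v t x = v y + t * fenchel g ((x - y) / t) &
      forall z, z <= x + L * t ->
        hopf_lax g v t x = v z + t * fenchel g ((x - z) / t) -> z <= y].
Proof.
move=> t0; have L_ge0 := L0; pose m := hopf_lax g v t x.
pose A := `[- L, L] `&` [set q | v (x - t * q) + t * fenchel g q <= m].
have cA : compact A.
  apply: (subclosed_compact _ (segment_compact (a := - L) (b := L))); last by move=> ? [].
  apply: closedI; first exact: interval_closed.
  apply: (@closed_comp _ _ _ [set z | z <= m]); last exact: closed_le.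
  by move=> q _; exact: cost_continuous.
have A0 : A !=set0.
  by have [q qL qE] := hopf_lax_attained x (ltW t0); exists q; split; rewrite /= ?in_itv//= -qE.
have [|q] := compact_EVT_min A0 cA (f := id).
  by apply: continuous_subspaceT => ?; exact: cvg_id.
rewrite inE => -[/= /[!in_itv]/= qL qm] qmin.
exists (x - t * q); split.
- by rewrite subKr (mulrC t) -mulNr !ler_pM2r//; lra.
- rewrite subKr mulrAC divff ?gt_eqF// mul1r.
  by apply/eqP; rewrite eq_le qm andbT hopf_lax_le ?ltW.
move=> z zx zE; rewrite lerBrDr -lerBrDl mulrC -ler_pdivlMr//.
have tz : t * ((x - z) / t) = x - z by rewrite mulrC divfK// gt_eqF.
have [Lz|zL] := leP ((x - z) / t) L; last by lra.
apply: qmin; rewrite inE; split => /=; last by rewrite tz subKr -zE.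
by rewrite in_itv/= Lz andbT ler_pdivlMr//; lra.
Qed.

End Datum.

(** On the right the segments from foot to point cross; exchanging the feet keeps the sum of the two
    speeds and narrows their spread, which a convex cost rewards. *)
Lemma fenchel_uncross t x x' y y' : 0 < t -> x <= x' -> y' <= y ->
  t * fenchel g ((x - y') / t) + t * fenchel g ((x' - y) / t) <=
  t * fenchel g ((x - y) / t) + t * fenchel g ((x' - y') / t).
Proof.
move=> t0 xx' yy'; rewrite -!mulrDr ler_wpM2l ?(ltW t0)//.
have := @convex_uncross _ (fenchel g) ((x - y) / t) ((x' - y) / t) ((y - y') / t)
  (fenchel_convex gs).
rewrite -!mulrDl (_ : x - y + _ = x - y'); last by lra.
rewrite (_ : x' - y + _ = x' - y'); last by lra.
by apply; rewrite ?ler_pM2r ?invr_gt0// ?divr_ge0 ?(ltW t0)//; lra.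
Qed.

Lemma hopf_lax_le_pt v t x y : lip r v -> 0 < t ->
  hopf_lax g v t x <= v y + t * fenchel g ((x - y) / t).
Proof.
move=> vr t0; have := hopf_lax_le vr x ((x - y) / t) (ltW t0).
by rewrite [t * ((x - y) / t)]mulrC divfK ?gt_eqF// subKr.
Qed.

Lemma monotone_minimizers v t : lip r v -> 0 < t -> exists Y : R -> R,
  [/\ {homo Y : x y / x <= y},
      forall x, - (L * t) <= x - Y x <= L * t &
      forall x, hopf_lax g v t x = v (Y x) + t * fenchel g ((x - Y x) / t)].
Proof.
move=> vr t0; have [Y YP] := choice (fun x => largest_minimizer_point vr x t0).
exists Y; split=> [x x' xx'|x|x]; [|by have [] := YP x|by have [] := YP x].
rewrite leNgt; apply/negP => Yx; suff : Y x <= Y x' by rewrite leNgt Yx.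
have [b E _] := YP x; have [b' E' max'] := YP x'.
(* With the feet in the wrong order, exchanging them would cost nothing, so [Y x] would be optimal
   for [x'] as well, against the maximality of [Y x']. *)
apply: max'; first lra.
have h1 := fenchel_uncross t0 xx' (ltW Yx).
have h2 := hopf_lax_le_pt x (Y x') vr t0.
have h3 := hopf_lax_le_pt x' (Y x) vr t0.
lra.
Qed.

(** A straight path splits into two of the same speed. Conversely, two consecutive pieces can be
    replaced by one straight path at their mean speed [q''], at no greater cost since the conjugate
    is convex. *)
Lemma hopf_lax_semigroup v s t x : lip r v -> 0 <= s -> 0 <= t ->
  hopf_lax g (hopf_lax g v s) t x = hopf_lax g v (s + t) x.
Proof.
move=> vr s0 t0; have Hr := hopf_lax_lip vr s0 vr.
apply/eqP; rewrite eq_le; apply/andP; split.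
  have [q _ ->] := hopf_lax_attained vr x (addr_ge0 s0 t0).
  have := hopf_lax_le Hr x q t0; have := hopf_lax_le vr (x - t * q) q s0.
  by rewrite (_ : x - t * q - s * q = x - (s + t) * q); lra.
have [q _ ->] := hopf_lax_attained Hr x t0.
have [q' _ ->] := hopf_lax_attained vr (x - t * q) s0.
have [->|s_neq0] := eqVneq s 0; first by rewrite !mul0r !add0r subr0 addr0 hopf_lax_le.
have st : 0 < s + t by rewrite ltr_wpDr// lt_neqAle eq_sym s_neq0.
pose q'' := (s * q' + t * q) / (s + t).
have stq : (s + t) * q'' = s * q' + t * q by rewrite mulrC divfK// gt_eqF.
have := hopf_lax_le vr x q'' (addr_ge0 s0 t0).
rewrite stq (_ : x - (s * q' + t * q) = x - t * q - s * q'); last by lra.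
suff : (s + t) * fenchel g q'' <= s * fenchel g q' + t * fenchel g q by lra.
have key a b qa qb : 0 <= a -> 0 <= b -> 0 < a + b -> qa <= qb ->
    (a + b) * fenchel g ((a * qa + b * qb) / (a + b)) <= a * fenchel g qa + b * fenchel g qb.
  move=> a0 b0 ab; rewrite le_eqVlt => /predU1P[->|qab].
    by rewrite -!mulrDl mulrAC divff ?mul1r// gt_eqF.
  set c := (_ / (a + b)).
  have cE : (a + b) * c = a * qa + b * qb by rewrite mulrC divfK// gt_eqF.
  have hb := ler_wpM2l b0 (ltW qab); have ha := ler_wpM2l a0 (ltW qab).
  have c1 : qa <= c by rewrite ler_pdivlMr//; lra.
  have c2 : c <= qb by rewrite ler_pdivrMr//; lra.
  have := fenchel_convex gs c1 c2 => /(ler_wpM2l (ltW ab)).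
  have e1 : (a + b) * (qb - c) = a * (qb - qa) by lra.
  have e2 : (a + b) * (c - qa) = b * (qb - qa) by lra.
  rewrite mulrDr !mulrA e1 e2 => h.
  rewrite -(@ler_pM2l _ (qb - qa)) ?subr_gt0//; lra.
have [qq|/ltW qq] := leP q' q; first exact: key.
by rewrite /q'' (addrC s) (addrC (s * q')) [leRHS]addrC key// addrC.
Qed.

Lemma hopf_lax_time_lip : exists2 C, 0 <= C & forall v t x h, lip r v ->
  0 <= t -> 0 <= h -> `|hopf_lax g v (t + h) x - hopf_lax g v t x| <= C * h.
Proof.
have L_ge0 := L0; have [K K0 gK] := convex_locally_lipschitz L (fenchel_convex gs).
pose F := `|fenchel g 0| + K * L.
have FP q : - L <= q <= L -> `|fenchel g q| <= F.
  move=> qL; have := gK q 0 qL ltac:(lra); rewrite subr0 => h.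
  rewrite -[fenchel g q](subrK (fenchel g 0)) (le_trans (ler_normD _ _))// addrC lerD2l.
  by rewrite (le_trans h)// ler_wpM2l// ler_norml.
(* [r * L] pays for moving the foot by at most [h * L], and [F] bounds the conjugate on [-L, L];
   neither depends on [v]. *)
exists (r * L + F); first by rewrite !addr_ge0 ?mulr_ge0.
move=> v t x h vr t0 h0; rewrite -hopf_lax_semigroup//.
have Hr := hopf_lax_lip vr t0 vr.
have [q qL ->] := hopf_lax_attained Hr x h0.
rewrite addrAC (le_trans (ler_normD _ _))// mulrDl lerD//.
  rewrite (le_trans (Hr _ _))// addrAC subrr add0r normrN normrM (ger0_norm h0) -mulrA ler_wpM2l//.
  by rewrite mulrC ler_wpM2r// ler_norml.
by rewrite normrM (ger0_norm h0) mulrC ler_wpM2r// FP.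
Qed.

End Flux.
End HopfLax.

(** * Derivatives of Lipschitz functions *)

Section DerivativeAlongHarmonic.
Context {R : realType}.
Implicit Types (F : R -> R) (k x l : R).

Definition quotient F x (h : R) := h^-1 * (F (h + x) - F x).

Lemma quotient_le k F x h : lip k F -> `|quotient F x h| <= k.
Proof.
move=> Fk; have [->|h0] := eqVneq h 0; first by rewrite /quotient invr0 mul0r normr0 (lip_ge0 Fk).
rewrite /quotient normrM normfV mulrC ler_pdivrMr ?normr_gt0//.
by rewrite (le_trans (Fk _ _))// addrK.
Qed.

(* For Lipschitz functions the difference quotients along [1/n] control all of
   them: [0 < h] lies between two consecutive [1/n], at relative distance at most
   [h]. *)
Lemma lip_quotient_cvg k F x l : lip k F ->
  quotient F x (harmonic n) @[n --> \oo] --> l ->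
  quotient F x (- harmonic n) @[n --> \oo] --> l ->
  quotient F x h @[h --> 0^'] --> l.
Proof.
move=> Fk /cvgrPdist_le Fp /cvgrPdist_le Fn; apply/cvgrPdist_le => e e0.
have e20 : 0 < e / 2 by rewrite divr_gt0.
have [[N1 _ H1] [N2 _ H2]] := (Fp _ e20, Fn _ e20).
pose N := maxn N1 N2.
have HN m : (N <= m)%N -> `|l - quotient F x (harmonic m)| <= e / 2 /\
    `|l - quotient F x (- harmonic m)| <= e / 2.
  rewrite geq_max => /andP[m1 m2]; split; [exact: H1|exact: H2].
have k0 : 0 < k + `|l| + 1 by rewrite ltr_wpDl// addr_ge0// (lip_ge0 Fk).
exists (Num.min (N.+1%:R^-1) (e / 2 / (k + `|l| + 1))) => /=.
  by rewrite lt_min invr_gt0 ltr0n /= divr_gt0.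
move=> h /=; rewrite sub0r normrN lt_min => /andP[hN he] h0.
have nh0 : 0 < `|h| by rewrite normr_gt0.
pose m := Num.truncn `|h|^-1.
have /andP[mh hm] : m%:R <= `|h|^-1 < m.+1%:R by apply: truncn_itv; rewrite invr_ge0.
have Nm : (N <= m)%N.
  have : N.+1%:R <= `|h|^-1 by rewrite -[leLHS]invrK lef_pV2 ?posrE ?invr_gt0// ltW.
  by move=> /le_lt_trans/(_ hm); rewrite ltr_nat => /ltnW.
pose h' := Num.sg h * harmonic m.
have h'E : `|h'| = harmonic m.
  by rewrite normrM normr_sg h0 mul1r ger0_norm// invr_ge0.
have sgh : Num.sg h * `|h| = h by rewrite -numEsg.
have m1 : 0 < m.+1%:R :> R by rewrite ltr0n.
have h'h : `|h'| <= `|h| by rewrite h'E -[leRHS]invrK lef_pV2 ?posrE ?invr_gt0// ltW.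
have hh' : `|h - h'| <= `|h| * `|h|.
  rewrite -{1}sgh -mulrBr normrM normr_sg h0 mul1r.
  rewrite -h'E ger0_norm ?subr_ge0//.
  apply: (@le_trans _ _ (`|h| * `|h'|)); last by rewrite ler_wpM2l.
  have hm1 : harmonic m * m.+1%:R = 1 :> R by apply: mulVf; rewrite gt_eqF.
  rewrite h'E -(ler_pM2r m1) mulrBl -mulrA hm1 mulr1.
  have : m%:R * `|h| <= 1 by rewrite -ler_pdivlMr// mul1r.
  rewrite -(natr1 m); lra.
have Q' : `|l - quotient F x h'| <= e / 2.
  rewrite /h'; have [hp|hn|/eqP] := ltgtP 0 h; last by rewrite eq_sym (negbTE h0).
    by rewrite gtr0_sg// mul1r; have [] := HN _ Nm.
  by rewrite ltr0_sg// mulN1r; have [] := HN _ Nm.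
have h'0 : h' != 0 by rewrite -normr_gt0 h'E invr_gt0.
rewrite -(ler_pM2l nh0) -normrM.
have -> : h * (l - quotient F x h) =
    (h - h') * l + h' * (l - quotient F x h') + (F (h' + x) - F (h + x)).
  by rewrite /quotient; field; rewrite h0 h'0.
have a1 : `|(h - h') * l| <= `|h| * `|h| * `|l| by rewrite normrM ler_wpM2r.
have a2 : `|h' * (l - quotient F x h')| <= `|h| * (e / 2) by rewrite normrM ler_pM.
have a3 : `|F (h' + x) - F (h + x)| <= k * (`|h| * `|h|).
  rewrite (le_trans (Fk _ _))// ler_wpM2l ?(lip_ge0 Fk)//.
  by rewrite (_ : _ - _ = - (h - h')) ?normrN//; ring.
rewrite (le_trans (ler_normD _ _))// (le_trans (lerD (ler_normD _ _) a3))//.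
have : `|h| * (k + `|l| + 1) <= e / 2 by rewrite -ler_pdivlMr// ltW.
move=> /(ler_wpM2l (ltW nh0)); have : 0 <= `|h| * `|h| by rewrite mulr_ge0.
lra.
Qed.

Lemma derivable_quotient F x : derivable F x 1 <-> cvg (quotient F x h @[h --> 0^']).
Proof.
have -> : quotient F x = (fun h => h^-1 *: (F (h *: 1 + x) - F x)).
  by apply/funext => h; rewrite /quotient/= [h *: _]mulr1.
by [].
Qed.

Lemma derive1_quotient F x : derive1 F x = lim (quotient F x h @[h --> 0^']).
Proof. by []. Qed.

(* [derive1] takes the value [point = 0] at points of non-derivability. *)
Lemma derive1_nondiff F x : ~ derivable F x 1 -> derive1 F x = 0.
Proof.
move=> ndF; rewrite derive1_quotient; apply: dvgP => H.
exact/ndF/derivable_quotient.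
Qed.

Lemma harmonic_dnbhs : harmonic n @[n --> \oo] --> (0 : R)^'.
Proof.
move=> A [e /= e0 eA].
have /cvgrPdist_lt/(_ _ e0)[N _ HN] := @cvg_harmonic R.
by exists N => // n Nn; apply: eA; [exact: HN|rewrite /= invr_eq0 pnatr_eq0].
Qed.

Lemma harmonicN_dnbhs : - harmonic n @[n --> \oo] --> (0 : R)^'.
Proof.
move=> A [e /= e0 eA].
have /cvgrPdist_lt/(_ _ e0)[N _ HN] := @cvg_harmonic R.
exists N => // n Nn; apply: eA; last by rewrite /= oppr_eq0 invr_eq0 pnatr_eq0.
by have := HN n Nn; rewrite /= !sub0r opprK normrN.
Qed.

Lemma lip_derivableP k F x l : lip k F ->
  (derivable F x 1 /\ derive1 F x = l) <->
  (quotient F x (harmonic n) @[n --> \oo] --> l /\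
   quotient F x (- harmonic n) @[n --> \oo] --> l).
Proof.
move=> Fk; split=> [[/derivable_quotient dF <-]|[hp hn]].
  split; [apply: (cvg_comp _ _ harmonic_dnbhs)|apply: (cvg_comp _ _ harmonicN_dnbhs)];
  rewrite derive1_quotient; exact: dF.
have lF := lip_quotient_cvg Fk hp hn; split; first by apply/derivable_quotient/cvg_ex; exists l.
by rewrite derive1_quotient; exact: cvg_lim lF.
Qed.

(* Derivability is convergence of the two quotient sequences to a common limit;
   the only candidate, [slope], is measurable as a limit superior. *)
Section Measurability.
Context d (T : measurableType d) (D : set T) (mD : measurable D).
Variables (F : T -> R -> R) (p : T -> R) (k : R).
Hypotheses (Fk : forall z, lip k (F z))
  (mF : forall h, measurable_fun D (fun z => F z (h + p z))).

Let mquotient h : measurable_fun D (fun z => quotient (F z) (p z) h).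
Proof.
apply: measurable_funM; first exact: measurable_cst.
apply: measurable_funB; first exact: mF.
by have := mF 0; under eq_fun do rewrite add0r.
Qed.

Let slope z : R := fine (limn_esup (fun n => (quotient (F z) (p z) (harmonic n))%:E)).

Let mslope : measurable_fun D slope.
Proof.
apply: measurableT_comp => //; apply: measurable_fun_limn_esup => n.
by apply/measurable_EFinP; exact: mquotient.
Qed.

Let slopeE z : derivable (F z) (p z) 1 -> slope z = derive1 (F z) (p z).
Proof.
move=> dz; have [hp _] := (lip_derivableP (p z) _ (Fk z)).1 (conj dz erefl).
have /cvg_limn_einf_sup[_ E] : (quotient (F z) (p z) (harmonic n))%:E @[n --> \oo] -->
  (derive1 (F z) (p z))%:E by apply: cvg_EFin => //; exact: nearW.
by rewrite /slope E.
Qed.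

Let error z n : \bar R := (`|quotient (F z) (p z) (harmonic n) - slope z| +
  `|quotient (F z) (p z) (- harmonic n) - slope z|)%:E.

Let isd z : bool := (limn_esup (error z) <= 0)%E.

Let misd : measurable_fun D isd.
Proof.
apply: measurable_fun_lee => //.
apply: (measurable_fun_limn_esup (f := fun n z => error z n)) => n.
apply/measurable_EFinP; apply: measurable_funD; apply: measurableT_comp => //;
  apply: measurable_funB => //; exact: mquotient.
Qed.

Let isdP z : isd z <-> derivable (F z) (p z) 1.
Proof.
split=> [zd|dz].
  have e0 : error z n @[n --> \oo] --> 0%E.
    by apply: limn_esup_le_cvg => // n; rewrite lee_fin addr_ge0.
  suff : quotient (F z) (p z) (harmonic n) @[n --> \oo] --> slope z /\
         quotient (F z) (p z) (- harmonic n) @[n --> \oo] --> slope z.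
    by move=> /(lip_derivableP (p z) (slope z) (Fk z)).2[].
  have {}e0 : fine (error z n) @[n --> \oo] --> (0 : R).
    by apply: (fine_cvg e0).
  split; apply/cvgrPdist_le => e e_gt0; move/cvgrPdist_le : e0 => /(_ e e_gt0);
    apply: filterS => n; rewrite /= sub0r normrN ger0_norm ?addr_ge0// (distrC (slope z));
    by apply: le_trans; rewrite ?lerDl ?lerDr ?normr_ge0.
have [hp hn] := (lip_derivableP (p z) _ (Fk z)).1 (conj dz erefl).
have : error z n @[n --> \oo] --> 0%E.
  have e0 (u : R^nat) : u n @[n --> \oo] --> derive1 (F z) (p z) ->
      `|u n - slope z| @[n --> \oo] --> (0 : R).
    by move=> uz; apply/norm_cvg0P; apply/subr_cvg0; rewrite slopeE.
  apply: cvg_EFin; [exact: nearW|rewrite -[0 in X in _ --> X]addr0; apply: cvgD; exact: e0].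
by rewrite /isd => /cvg_limn_einf_sup[_ ->].
Qed.

Lemma measurable_lip_derivable : measurable (D `&` [set z | derivable (F z) (p z) 1]).
Proof.
rewrite (_ : [set _ | _] = isd @^-1` [set true]); first exact: misd.
by apply/seteqP; split=> z /=; [move/isdP|move=> H; apply/isdP].
Qed.

Lemma measurable_lip_derive1 : measurable_fun D (fun z => derive1 (F z) (p z)).
Proof.
apply: (@eq_measurable_fun _ _ _ _ D (fun z => if isd z then slope z else point)).
  move=> z _; case: ifPn => [/isdP/slopeE//|/negP ndz].
  by rewrite derive1_nondiff// => /isdP.
apply: measurable_fun_if => //.
by apply: measurable_funS mslope => //; exact: subIsetl.
Qed.
End Measurability.

End DerivativeAlongHarmonic.

Section Lipschitz_ae.
Context {R : realType}.
Local Notation mu := (@lebesgue_measure R).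
Implicit Types (F G : R -> R) (k x y a b : R).

Lemma ae_imp d (T : measurableType d) (m : {measure set T -> \bar R}) (P Q : T -> Prop) :
  {ae m, forall z, P z} -> (forall z, P z -> Q z) -> {ae m, forall z, Q z}.
Proof.
by move=> mP PQ; exact: (@filterS _ _ (ae_filter_ringOfSetsType m) _ _ PQ).
Qed.

Lemma ae_and d (T : measurableType d) (m : {measure set T -> \bar R}) (P Q : T -> Prop) :
  {ae m, forall z, P z} -> {ae m, forall z, Q z} -> {ae m, forall z, P z /\ Q z}.
Proof. by move=> mP mQ; exact: (@filterI _ _ (ae_filter_ringOfSetsType m) _ _ mP mQ). Qed.

Lemma itv_bnd_lty (b1 b2 : bool) x y : (mu [set` Interval (BSide b1 x) (BSide b2 y)] < +oo)%E.
Proof. by rewrite lebesgue_measure_itv/=; case: ifPn => // _; rewrite -EFinB ltry. Qed.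

Section Density.
Variable G : R -> R.
Hypothesis G1 : forall x y, x <= y -> 0 <= G y - G x <= y - x.

Let G_nd : nondecreasing G.
Proof. by move=> x y xy; have := G1 xy; lra. Qed.

Let G_lip : lip 1 G.
Proof.
move=> x y; rewrite mul1r; have [xy|/ltW xy] := leP x y; have := G1 xy.
  by rewrite distrC (distrC x) => /andP[h0 h1]; rewrite !ger0_norm ?subr_ge0 ?G_nd.
by move=> /andP[h0 h1]; rewrite !ger0_norm ?subr_ge0 ?G_nd.
Qed.

Let G_rc : right_continuous G.
Proof. exact/right_continuousW/(lip_continuous G_lip). Qed.

Let Gc : cumulative R R := HB.pack G (isCumulative.Build R _ R G G_nd G_rc).

(** Both sides are infima over covers by half-open intervals, and on each interval the increment of
    [G] is at most the length. *)
Let stieltjes_le A : (lebesgue_stieltjes_measure Gc A <= mu A)%E.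
Proof.
apply: le_ereal_inf_tmp => _ [F [mF AF] <-].
apply: (@le_trans _ _ (\sum_(k <oo) wlength Gc (F k))%E).
  by by apply: ge_ereal_inf; exists (\sum_(k <oo) wlength Gc (F k))%E => //; exists F.
apply: lee_nneseries => [n _ _|n _]; first exact: wlength_ge0.
have /ocitvP[->|[[a b] /= ab ->]] := mF n; first by rewrite !wlength0.
rewrite !wlength_itv_bnd ?(ltW ab)//= lee_fin.
by have /andP[] := G1 (ltW ab).
Qed.

Lemma contraction_density N : exists rho : R -> R,
  mu.-integrable setT (EFin \o rho) /\
  forall x y, - N <= x -> x <= y -> y <= N ->
    \int[mu]_(t in `]x, y]) rho t = G y - G x.
Proof.
pose D := `](- N), N]%classic : set (measurableTypeR R).
have mD : measurable D by exact: measurable_itv.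
pose nu0 := lebesgue_stieltjes_measure Gc.
have Dfin : (nu0 D < +oo)%E.
  apply: (le_lt_trans (stieltjes_le D)).
  exact: itv_bnd_lty.
(* Cutting to [D] makes the measure finite, so that its density is integrable on the whole line. *)
pose nu : {finite_measure set _ -> \bar R} := mfrestr mD Dfin.
have numu : nu `<< mu.
  apply/null_content_dominatesP => A mA A0; apply/eqP; rewrite eq_le measure_ge0 andbT.
  rewrite -A0; apply: (le_trans _ (stieltjes_le A)).
  by apply: le_measure; rewrite ?inE//; exact: measurableI.
have [f [f0 ffin fint fE]] := radon_nikodym_sigma_finite numu.
exists (fine \o f); have ff : EFin \o (fine \o f) = f.
  by apply/funext => x /=; rewrite fineK.
rewrite ff; split=> // x y Nx xy yN; rewrite /Rintegral.
have -> : (fun t => ((fine \o f) t)%:E) = f by exact: ff.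
rewrite -fE//= /mfrestr /mrestr setIidl; last first.
  by apply: subset_itv; rewrite bnd_simp.
rewrite /nu0 /lebesgue_stieltjes_measure/= /measure_extension.
rewrite measurable_mu_extE/=; last exact: is_ocitv.
by rewrite wlength_itv_bnd.
Qed.

End Density.

(* After adding [k x] and rescaling, [F] becomes nondecreasing with slopes at most
   1, so that its Stieltjes measure is dominated by Lebesgue measure and has a
   Radon-Nikodym density. *)
Lemma lip_density k F N : lip k F -> exists rho : R -> R,
  mu.-integrable `]- N, N] (EFin \o rho) /\
  forall x y, - N <= x -> x <= y -> y <= N ->
    \int[mu]_(t in `]x, y]) rho t = F y - F x.
Proof.
move=> Fk; have k0 := lip_ge0 Fk.
(* [F x + k * x] has slopes in [0, 2k]; the extra 1 keeps [c] positive when [k = 0]. *)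
pose c := 2 * k + 1; have c0 : 0 < c by rewrite ltr_wpDl// mulr_ge0.
pose G x := c^-1 * (F x + k * x).
have G1 x y : x <= y -> 0 <= G y - G x <= y - x.
  move=> xy; have := Fk y x; rewrite (ger0_norm (x := y - x)) ?subr_ge0// => /ler_normlP[h1 h2].
  rewrite /G -mulrBr; apply/andP; split.
    by rewrite ler_wpM2l ?invr_ge0 ?(ltW c0)//; lra.
  rewrite mulrC ler_pdivrMr// /c; have := subr_ge0 x y; rewrite xy; lra.
have [rho [irho rhoE]] := contraction_density G1 N.
have iD x y : mu.-integrable `]x, y] (EFin \o rho).
  by apply: integrableS irho => //; exact: measurable_itv.
have ic x y : mu.-integrable `]x, y] (EFin \o cst k).
  apply: measurable_bounded_integrable => //; first exact: itv_bnd_lty.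
  by exists `|k|; split; [rewrite num_real|move=> M kM z _; exact: ltW].
have icr x y : mu.-integrable `]x, y] (EFin \o (fun t => c * rho t)).
  by apply: (integrableZl _ c (iD x y)); exact: measurable_itv.
exists (fun t => c * rho t - k); split.
  by apply: (integrableB _ (icr _ _) (ic _ _)); exact: measurable_itv.
move=> x y Nx xy yN; rewrite RintegralB// RintegralZl// rhoE//.
rewrite Rintegral_cst//= lebesgue_measure_itv/= /G.
have -> : fine (if (x < y)%R then (y%:E - x%:E)%E else 0%E) = y - x :> R.
  by case: ltP => [//|yx]; have -> : y = x; [apply/eqP; rewrite eq_le xy yx|rewrite subrr].
by field; rewrite gt_eqF.
Qed.

(** Lebesgue differentiation of the integral of [rho] cut to []- N, N]], from which [F] differs by a
    constant near each interior point. It serves Lipschitz functions, and also primitives, whose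
    density is known. *)
Lemma ae_derive_of_density F rho N : mu.-integrable `]- N, N] (EFin \o rho) ->
  (forall x y, - N <= x -> x <= y -> y <= N -> \int[mu]_(t in `]x, y]) rho t = F y - F x) ->
  {ae mu, forall x, - N < x < N -> derivable F x 1 /\ derive1 F x = rho x}.
Proof.
move=> irho rhoE.
pose D := `]- N, N]%classic.
have mD : measurable (D : set (measurableTypeR R)) by exact: measurable_itv.
have irD : mu.-integrable setT (EFin \o (rho \_ D)).
  by rewrite -restrict_EFin; apply/(integrable_mkcond _ mD).
have locrho : locally_integrable setT (rho \_ D) by exact: integrable_locally.
have := FTC1 (f := rho \_ D) (a := BRight (- N)) _ locrho.
have irDy y : mu.-integrable [set` Interval (BRight (- N)) (BRight y)] (EFin \o (rho \_ D)).
  by apply: integrableS irD => //; exact: measurable_itv.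
move=> /(_ irDy).
move/ae_imp; apply=> x /= + /andP[nx xn] => /(_ nx)[dP].
have PF : \forall y \near x, F y = \int[mu]_(t in `](- N), y]) (rho \_ D) t + F (- N).
  have xN : x \in `]- N, N[ by rewrite in_itv/= nx xn.
  apply: filterS (near_in_itvoo xN) => y; rewrite in_itv/= => /andP[Ny yN].
  rewrite (@eq_Rintegral _ _ _ mu _ rho) ?rhoE ?subrK ?(ltW Ny) ?(ltW yN)//.
  move=> t; rewrite inE/= in_itv/= => /andP[Nt ty]; rewrite patchE mem_set//=.
  by rewrite /D/= in_itv/= Nt (le_trans ty)// ltW.
have d2 := derivableD dP (derivable_cst (F (- N)) x 1).
have xD : x \in D by rewrite inE /D/= in_itv/= nx ltW.
rewrite patchE xD => dE; split.
  by apply: near_eq_derivable d2; apply: filterS PF => y ->.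
rewrite derive1E (near_eq_derive _ PF) deriveD//.
by rewrite derive_cst addr0 -derive1E.
Qed.

Let lip_ae_density k F N : lip k F -> exists rho : R -> R,
  [/\ mu.-integrable `]- N, N] (EFin \o rho),
     forall x y, - N <= x -> x <= y -> y <= N ->
       \int[mu]_(t in `]x, y]) rho t = F y - F x &
     {ae mu, forall x, - N < x < N -> derivable F x 1 /\ derive1 F x = rho x}].
Proof.
move=> Fk; have [rho [irho rhoE]] := lip_density N Fk; exists rho; split=> //.
exact: ae_derive_of_density.
Qed.

Lemma lip_ae_derivable k F : lip k F -> {ae mu, forall x, derivable F x 1}.
Proof.
move=> Fk; have H n : {ae mu, forall x, - n%:R < x < n%:R -> derivable F x 1}.
  have [rho [_ _]] := lip_ae_density n%:R Fk.
  by move/ae_imp; apply=> x H /H[].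
move/ae_foralln/ae_imp : H; apply=> x H.
apply: (H (Num.truncn `|x|).+1); rewrite -ltr_norml; exact: truncnS_gt.
Qed.

Lemma lip_measurable_derive1 k F D : lip k F -> measurable D ->
  measurable_fun (D : set (measurableTypeR R)) (derive1 F).
Proof.
move=> Fk mD; apply: (measurable_lip_derive1 mD (F := fun=> F) (p := id) (k := k)) => // h.
apply: measurable_funTS; apply: continuous_measurable_fun => x.
apply: continuous_comp; last exact: lip_continuous Fk _.
by apply: cvgD; [exact: cvg_cst|exact: cvg_id].
Qed.

Lemma lip_derive1_le k F x : lip k F -> `|derive1 F x| <= k.
Proof.
move=> Fk; have [dF|ndF] := pselect (derivable F x 1); last first.
  by rewrite derive1_nondiff// normr0 (lip_ge0 Fk).
have [hp _] := (lip_derivableP x _ Fk).1 (conj dF erefl).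
rewrite -(cvg_lim (@Rhausdorff R) (cvg_norm hp)).
apply: limr_le; first exact: cvgP (cvg_norm hp).
by apply: nearW => n; exact: quotient_le.
Qed.

Lemma lip_integrable_derive1 k F a b : lip k F ->
  mu.-integrable `[a, b] (EFin \o derive1 F).
Proof.
move=> Fk; apply: measurable_bounded_integrable.
- exact: measurable_itv.
- exact: itv_bnd_lty.
- apply: lip_measurable_derive1 Fk _; exact: measurable_itv.
- exists k; split; first by rewrite num_real.
  by move=> M kM x _; exact: le_trans (lip_derive1_le x Fk) (ltW kM).
Qed.

Lemma lip_FTC k F a b : lip k F -> a <= b ->
  \int[mu]_(x in `[a, b]) derive1 F x = F b - F a.
Proof.
move=> Fk ab; pose N := `|a| + `|b| + 1.
have Na : - N <= a by rewrite /N; have := ler_norm (- a); rewrite normrN; have := normr_ge0 b; lra.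
have bN : b < N by rewrite /N; have := ler_norm b; have := normr_ge0 a; lra.
have [rho [irho rhoE aeE]] := lip_ae_density N Fk.
rewrite -(rhoE a b)// ?ltW// -Rintegral_itv_obnd_cbnd; last first.
  apply: integrableS (lip_integrable_derive1 a b Fk) => //.
  by apply: subset_itv; rewrite bnd_simp.
rewrite /Rintegral; congr fine; apply: ae_eq_integral => //.
- by apply/measurable_EFinP; exact: lip_measurable_derive1 Fk _.
- move: irho => /measurable_int; apply: measurable_funS => //.
  by apply: subset_itv; rewrite bnd_simp// ltW.
- apply: (ae_imp aeE) => x /= H; rewrite in_itv/= => /andP[ax xb].
  by have [_ ->//] := H ltac:(lra).
Qed.

End Lipschitz_ae.

(** * Viscosity inequalities *)

Section Viscosity.
Context {R : realType}.
Implicit Types (phi : R * R -> R) (z : R * R) (x t h q e : R).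

Lemma slice_x phi x t : derivable phi (x, t) (1, 0) ->
  derivable (fun y => phi (y, t)) x 1 /\ derive1 (fun y => phi (y, t)) x = Dx phi (x, t).
Proof.
have E : (fun h : R => h^-1 *: (phi (h *: (1, 0) + (x, t)) - phi (x, t))) =
    (fun h : R => h^-1 *: (phi (h *: 1 + x, t) - phi (x, t))).
  by apply/funext => h; congr (_ *: (phi _ - _)); congr pair; rewrite /= scaler0 add0r.
by rewrite derive1E /Dx /derive /derivable E.
Qed.

Lemma slice_t phi x t : derivable phi (x, t) (0, 1) ->
  derivable (fun s => phi (x, s)) t 1 /\ derive1 (fun s => phi (x, s)) t = Dt phi (x, t).
Proof.
have E : (fun h : R => h^-1 *: (phi (h *: (0, 1) + (x, t)) - phi (x, t))) =
    (fun h : R => h^-1 *: (phi (x, h *: 1 + t) - phi (x, t))).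
  by apply/funext => h; congr (_ *: (phi _ - _)); congr pair; rewrite /= scaler0 add0r.
by rewrite derive1E /Dt /derive /derivable E.
Qed.

Lemma mvt_bound (f : R -> R) a b l e :
  (forall c, `|b - c| <= `|b - a| -> derivable f c 1 /\ `|derive1 f c - l| <= e) ->
  `|f b - f a - l * (b - a)| <= e * `|b - a|.
Proof.
move=> H.
have df c : `|b - c| <= `|b - a| -> is_derive c 1 f (derive1 f c).
  by move=> /H[dc _]; rewrite derive1E; apply: DeriveDef.
have cf c : `|b - c| <= `|b - a| -> {for c, continuous f}.
  by move=> /H[dc _]; apply: differentiable_continuous; exact/derivable1_diffP.
have [ab|ba] := leP a b.
  have sub c : c \in `[a, b] -> `|b - c| <= `|b - a|.
    by rewrite in_itv/= => /andP[ac cb]; rewrite !ger0_norm ?subr_ge0// lerB.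
  have [c cab ->] := MVT_segment ab (fun c cab => df c (sub c (subset_itv_oo_cc cab)))
    (continuous_in_subspaceT (fun c cab => cf c (sub c (set_mem cab)))).
  by rewrite -mulrBl normrM ler_wpM2r// (H _ (sub _ cab)).2.
have sub c : c \in `[b, a] -> `|b - c| <= `|b - a|.
  rewrite in_itv/= => /andP[bc ca]; rewrite !ler0_norm ?subr_le0 ?(ltW ba)//; lra.
have [c cab E] := MVT_segment (ltW ba) (fun c cab => df c (sub c (subset_itv_oo_cc cab)))
    (continuous_in_subspaceT (fun c cab => cf c (sub c (set_mem cab)))).
rewrite (_ : f b - f a = derive1 f c * (b - a)); last by lra.
by rewrite -mulrBl normrM ler_wpM2r// (H _ (sub _ cab)).2.
Qed.

Lemma taylor1 phi z M e : Ck open_half 1 phi -> open_half z -> 0 <= M -> 0 < e ->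
  exists2 d, 0 < d & forall h q, 0 <= h -> h < d -> `|q| <= M ->
    `|phi z - phi (z.1 - h * q, z.2 - h) - h * (Dt phi z + q * Dx phi z)| <= e * h.
Proof.
case: z => x t -[_ [dphi [cx _] [ct _]]] [_ /=]; rewrite in_itv/= andbT => t0 M0 e0.
have zH : open_half (x, t) by split; rewrite //= in_itv/= t0.
pose e' := e / (M + 1); have M1 : 0 < M + 1 by rewrite ltr_wpDl.
have e'0 : 0 < e' by rewrite divr_gt0.
have : \forall w \near (x, t), [/\ open_half w, `|Dt phi (x, t) - Dt phi w| <= e' &
    `|Dx phi (x, t) - Dx phi w| <= e'].
  have Ho : \forall w \near (x, t), open_half w.
    have : \forall w \near (x, t), 0 < w.2.
      exists (setT, [set s | 0 < s]) => /=; last by case=> y s [].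
      by split; [exact: filterT|exact: lt_nbhsr].
    by apply: filterS => -[y s] /= s0; split; rewrite //= in_itv/= s0.
  have /cvgrPdist_le/(_ _ e'0) Ht := ct _ zH.
  have /cvgrPdist_le/(_ _ e'0) Hx := cx _ zH.
  by near=> w; split; near: w.
move=> /nbhs_ballP[d /= d0 Hd].
have Hd' y s : `|x - y| < d -> `|t - s| < d -> [/\ open_half (y, s),
    `|Dt phi (x, t) - Dt phi (y, s)| <= e' & `|Dx phi (x, t) - Dx phi (y, s)| <= e'].
  by move=> xy ts; exact: (Hd (y, s) (conj xy ts)).
exists (d / (M + 1)); first exact: divr_gt0.
move=> h q h0; rewrite ltr_pdivlMr// => hd qM.
have hqM : h * `|q| <= h * M by rewrite ler_wpM2l.
have hM : 0 <= h * M by rewrite mulr_ge0.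
have b1 : `|phi (x, t) - phi (x, t - h) - Dt phi (x, t) * (t - (t - h))| <= e' * `|t - (t - h)|.
  apply: (@mvt_bound (fun s => phi (x, s))) => c; rewrite subKr (ger0_norm h0) => tc.
  have [|| H1 H2 _] := Hd' x c; [rewrite subrr normr0//|lra|].
  by have [dc ->] := slice_t (dphi _ H1).2; rewrite distrC.
have b2 : `|phi (x, t - h) - phi (x - h * q, t - h) - Dx phi (x, t) * (x - (x - h * q))|
    <= e' * `|x - (x - h * q)|.
  apply: (@mvt_bound (fun y => phi (y, t - h))) => c; rewrite subKr normrM (ger0_norm h0) => xc.
  have [|| H1 _ H2] := Hd' c (t - h); [lra|rewrite subKr ger0_norm//; lra|].
  by have [dc ->] := slice_x (dphi _ H1).1; rewrite distrC.
move: b1 b2; rewrite !subKr normrM (ger0_norm h0) => b1 b2.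
rewrite (_ : phi _ - _ - _ = (phi (x, t) - phi (x, t - h) - Dt phi (x, t) * h) +
  (phi (x, t - h) - phi (x - h * q, t - h) - Dx phi (x, t) * (h * q))); last by ring.
rewrite (le_trans (ler_normD _ _))// (le_trans (lerD b1 b2))//.
have -> : e = e' * (M + 1) by rewrite divfK// gt_eqF.
by rewrite -mulrDr -mulrA ler_wpM2l ?(ltW e'0)//; lra.
Unshelve. all: by end_near. Qed.

(* The hypothesis is one-sided, as given by a local extremum of [V - phi]. *)
Lemma derivable_le_lip (f : R -> R) x r : derivable f x 1 ->
  (\forall y \near x, f x - f y <= r * `|x - y|) -> `|derive1 f x| <= r.
Proof.
move=> /derivable_quotient df fr.
have q0 : quotient f x h @[h --> 0^'] --> derive1 f x by rewrite derive1_quotient; exact: df.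
have near0 : \forall h \near (0 : R), f x - f (h + x) <= r * `|h|.
  have [d /= d0 Hd] := fr; exists d => // h /=; rewrite sub0r normrN => hd.
  have := Hd (h + x); rewrite /= opprD addrCA subrr addr0 normrN; exact.
apply/ler_addgt0Pr => e e0.
have [d1 /= d10 H1] := near0.
move/cvgrPdist_le : q0 => /(_ _ e0)[d2 /= d20 H2].
have H (h : R) : h != 0 -> `|h| < Num.min d1 d2 ->
    f x - f (h + x) <= r * `|h| /\ `|derive1 f x - quotient f x h| <= e.
  rewrite lt_min => h0 /andP[h1 h2].
  by split; [apply: H1; rewrite /= sub0r normrN|apply: H2; rewrite //= sub0r normrN].
pose h := Num.min d1 d2 / 2.
have h0 : 0 < h by rewrite divr_gt0// lt_min d10.
have hd : h < Num.min d1 d2 by rewrite /h; move: h0; rewrite /h; lra.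
have nh : `|h| = h by rewrite gtr0_norm.
have h_n0 : h != 0 by rewrite gt_eqF.
have [Hp /ler_normlP[Qp Qp']] := H h h_n0 ltac:(by rewrite nh).
have [Hn /ler_normlP[Qn Qn']] := H (- h) ltac:(by rewrite oppr_eq0) ltac:(by rewrite normrN nh).
move: Hp Hn; rewrite normrN nh => Hp Hn.
have p1 : - r <= quotient f x h.
  by rewrite /quotient mulrC ler_pdivlMr//; lra.
have n1 : quotient f x (- h) <= r.
  by rewrite /quotient invrN mulNr mulrC -mulNr ler_pdivrMr//; lra.
by rewrite ler_norml; apply/andP; split; lra.
Qed.

Lemma C1_derivable_x phi z : Ck open_half 1 phi -> open_half z ->
  derivable (fun y => phi (y, z.2)) z.1 1 /\ derive1 (fun y => phi (y, z.2)) z.1 = Dx phi z.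
Proof. by case: z => x t -[_ [dphi _ _]] /dphi[/slice_x]. Qed.

Lemma near_slice (x t : R) (P : R * R -> Prop) :
  (\forall w \near (x, t), P w) -> \forall y \near x, P (y, t).
Proof.
move=> /nbhs_ballP[d /= d0 H]; apply/nbhs_ballP; exists d => // y xy.
by apply: H; split => //=; exact: ballxx.
Qed.

Section HopfLaxViscosity.
Variables (f g : R -> R) (r L : R) (V : R -> R -> R).
Hypotheses (gc : convexR g) (gs : finite_conjugate g) (r0 : 0 <= r) (L0 : 0 <= L)
  (fg : forall p, `|p| <= r -> f p = g p)
  (Vr : forall t, 0 <= t -> lip r (V ^~ t))
  (Vle : forall x t h q, 0 <= h -> h <= t ->
     V x t <= V (x - h * q) (t - h) + h * fenchel g q)
  (Veq : forall x t h, 0 <= h -> h <= t -> exists2 q, `|q| <= L &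
     V x t = V (x - h * q) (t - h) + h * fenchel g q).

Lemma near_back (x t M : R) (P : R * R -> Prop) : 0 < t -> 0 <= M ->
  (\forall w \near (x, t), P w) ->
  exists2 d, 0 < d & forall h q, 0 <= h -> h < d -> `|q| <= M ->
    h <= t /\ P (x - h * q, t - h).
Proof.
move=> t0 M0 /nbhs_ballP[d /= d0 H].
have M1 : 0 < M + 1 by rewrite ltr_wpDl.
exists (Num.min t (d / (M + 1))); first by rewrite lt_min t0 divr_gt0.
move=> h q h0; rewrite lt_min ltr_pdivlMr// => /andP[/ltW ht hd] qM; split=> //.
have hqM : h * `|q| <= h * M by rewrite ler_wpM2l.
have hM : 0 <= h * M by rewrite mulr_ge0.
by apply: H; split; rewrite /= /ball/= subKr ?normrM ?(ger0_norm h0); lra.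
Qed.

Lemma hopf_lax_subsolution phi z : Ck open_half 1 phi -> open_half z ->
  (\forall w \near z, V w.1 w.2 - phi w <= V z.1 z.2 - phi z) ->
  Dt phi z + f (Dx phi z) <= 0.
Proof.
move=> phiC zH Vphi; have [dx dxE] := C1_derivable_x phiC zH.
case: z => x t /= in zH Vphi dx dxE *.
have t0 : 0 < t by have [_] := zH; rewrite /= in_itv/= andbT.
rewrite fg; last first.
  rewrite -dxE; apply: derivable_le_lip => //; apply: filterS (near_slice Vphi) => y /= Vy.
  by have := Vr (ltW t0) x y => /ler_normlP[_]; lra.
set p := Dx phi (x, t); have [q gq] := subgrad_exists p gc.
have gE := fenchel_subgrad gs gq.
apply/ler_addgt0Pr => e e0; rewrite add0r.
have [d1 d10 H1] := near_back t0 (normr_ge0 q) Vphi.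
have [d2 d20 H2] := taylor1 phiC zH (normr_ge0 q) e0.
pose h := Num.min d1 d2 / 2.
have h0 : 0 < h by rewrite divr_gt0// lt_min d10.
have [h1 h2] : h < d1 /\ h < d2.
  by apply/andP; rewrite -lt_min; move: h0; rewrite /h; lra.
have [ht A] := H1 h q (ltW h0) h1 (lexx _).
have /ler_normlP[B _] := H2 h q (ltW h0) h2 (lexx _).
have := Vle x q (ltW h0) ht; rewrite gE => C.
rewrite -(ler_pM2l h0); move: A B C; rewrite /= -/p; lra.
Qed.

Lemma hopf_lax_supersolution phi z : Ck open_half 1 phi -> open_half z ->
  (\forall w \near z, V z.1 z.2 - phi z <= V w.1 w.2 - phi w) ->
  0 <= Dt phi z + f (Dx phi z).
Proof.
move=> phiC zH Vphi; have [dx dxE] := C1_derivable_x phiC zH.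
case: z => x t /= in zH Vphi dx dxE *.
have t0 : 0 < t by have [_] := zH; rewrite /= in_itv/= andbT.
rewrite fg; last first.
  rewrite -dxE -normrN.
  have <- : derive1 (fun y => - phi (y, t)) x = - derive1 (fun y => phi (y, t)) x.
    by rewrite !derive1E deriveN.
  apply: derivable_le_lip; first exact: derivableN.
  apply: filterS (near_slice Vphi) => y /= Vy.
  by have := Vr (ltW t0) x y => /ler_normlP[+ _]; lra.
set p := Dx phi (x, t).
rewrite -lerN2 oppr0; apply/ler_addgt0Pr => e e0; rewrite add0r.
have [d1 d10 H1] := near_back t0 L0 Vphi.
have [d2 d20 H2] := taylor1 phiC zH L0 e0.
pose h := Num.min d1 d2 / 2.
have h0 : 0 < h by rewrite divr_gt0// lt_min d10.
have [h1 h2] : h < d1 /\ h < d2.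
  by apply/andP; rewrite -lt_min; move: h0; rewrite /h; lra.
have ht : h <= t by have [] := H1 h 0 (ltW h0) h1; rewrite ?normr0.
have [q qL VE] := Veq x (ltW h0) ht.
have [_ A] := H1 h q (ltW h0) h1 qL.
have /ler_normlP[_ B] := H2 h q (ltW h0) h2 qL.
have := fenchel_young gs p q => /(ler_wpM2l (ltW h0)) C.
rewrite -(ler_pM2l h0); move: A B C VE; rewrite /= -/p; lra.
Qed.

End HopfLaxViscosity.
End Viscosity.

(** * Weak formulation *)

Section WeakFormulation.
Context {R : realType}.
Local Notation mu := (@lebesgue_measure R).
Implicit Types (x t h q e k N : R).

Lemma derivable_expansion (w : R -> R) x e : derivable w x 1 -> 0 < e ->
  exists2 d, 0 < d & forall s, `|s| < d -> `|w (s + x) - w x - s * derive1 w x| <= e * `|s|.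
Proof.
move=> /derivable_quotient dw e0.
have : quotient w x h @[h --> 0^'] --> derive1 w x by rewrite derive1_quotient; exact: dw.
move=> /cvgrPdist_le/(_ _ e0)[d /= d0 H]; exists d => // s sd.
have [->|s0] := eqVneq s 0; first by rewrite add0r mul0r !subrr !normr0 mulr0.
have := H s; rewrite /= sub0r normrN => /(_ sd s0).
rewrite -(ler_pM2r (x := `|s|)) ?normr_gt0// -normrM; apply: le_trans.
by rewrite -normrN le_eqVlt; apply/orP; left; apply/eqP; rewrite /quotient; congr `|_|; field.
Qed.

Lemma integral_lip_mul k m N (V psi : R -> R) : 0 <= N -> lip k V -> lip m psi ->
  (forall x, N <= `|x| -> psi x = 0) ->
  \int[mu]_(x in `[- N, N]) (derive1 V x * psi x + V x * derive1 psi x) = 0.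
Proof.
move=> N0 Vk psim psi0; have [k0 m0] := (lip_ge0 Vk, lip_ge0 psim).
pose W x := V x * psi x.
pose B := m * (2 * N); pose A := `|V 0| + k * N.
have A0 : 0 <= A by rewrite addr_ge0 ?mulr_ge0.
have psiN : psi N = 0 by rewrite psi0 ?ger0_norm.
have psiB x : `|psi x| <= B.
  have [xN|Nx] := leP `|x| N; last by rewrite psi0 ?(ltW Nx)// normr0 !mulr_ge0.
  rewrite -[psi x]subr0 -psiN (le_trans (psim _ _))// ler_wpM2l//.
  by rewrite (le_trans (ler_normB _ _))// (ger0_norm N0); lra.
have VA x : `|x| <= N -> `|V x| <= A.
  move=> xN; rewrite -[V x](subrK (V 0)) (le_trans (ler_normD _ _))// addrC lerD2l.
  by rewrite (le_trans (Vk _ _))// subr0 ler_wpM2l.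
have Wside x y : `|x| <= N -> `|W x - W y| <= (A * m + k * B) * `|x - y|.
  move=> xN; rewrite (_ : W x - W y = V x * (psi x - psi y) + (V x - V y) * psi y); last first.
    by rewrite /W; ring.
  rewrite (le_trans (ler_normD _ _))// !normrM mulrDl lerD//.
    by rewrite -mulrA ler_pM// VA.
  by rewrite mulrAC ler_pM.
have Wlip : lip (A * m + k * B) W.
  move=> x y; have [/Wside//|xN] := leP `|x| N.
  have [yN|yN] := leP `|y| N; first by rewrite distrC (distrC x) Wside.
  rewrite /W (psi0 x) ?(psi0 y) ?(ltW xN) ?(ltW yN)// !mulr0 subrr normr0.
  by rewrite mulr_ge0// addr_ge0// ?mulr_ge0//.
transitivity (\int[mu]_(x in `[- N, N]) derive1 W x); last first.
  rewrite (lip_FTC Wlip); last lra.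
  by rewrite /W !psi0 ?normrN ?ger0_norm// !mulr0 subrr.
have mset : measurable (`[- N, N]%classic : set (measurableTypeR R)) by exact: measurable_itv.
have mc (F : R -> R) j : lip j F -> measurable_fun (`[- N, N]%classic : set (measurableTypeR R)) F.
  by move=> /lip_continuous Fc; apply: measurable_funTS; exact: continuous_measurable_fun.
rewrite /Rintegral; congr fine; apply: ae_eq_integral => //.
- apply/measurable_EFinP; apply: measurable_funD; apply: measurable_funM.
  + exact: lip_measurable_derive1 Vk _.
  + exact: mc psim.
  + exact: mc Vk.
  + exact: lip_measurable_derive1 psim _.
- by apply/measurable_EFinP; exact: lip_measurable_derive1 Wlip _.
have dV := lip_ae_derivable Vk; have dpsi := lip_ae_derivable psim.
apply: (ae_imp (ae_and dV dpsi)) => x [dVx dpsix] _; congr EFin.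
rewrite !derive1E /W deriveM//= /GRing.scale/=; ring.
Qed.
Section BoundedOnInterval.
Variable a b : R.
Local Notation I := (`[a, b]%classic : set (measurableTypeR R)).

Let mI : measurable I. Proof. exact: measurable_itv. Qed.

Lemma bounded_integrable_itv (F : R -> R) K : measurable_fun I F ->
  (forall x, a <= x <= b -> `|F x| <= K) -> mu.-integrable I (EFin \o F).
Proof.
move=> mF FK; apply: measurable_bounded_integrable => //; first exact: itv_bnd_lty.
exists K; split; [rewrite num_real//|move=> M /ltW KM x /=].
by rewrite in_itv/= => /FK/le_trans; apply.
Qed.

Lemma Rintegral_itv_le (F : R -> R) K : a <= b -> measurable_fun I F ->
  (forall x, a <= x <= b -> `|F x| <= K) -> `|\int[mu]_(x in I) F x| <= K * (b - a).
Proof.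
move=> ab mF FK; have iF := bounded_integrable_itv mF FK.
have iK : mu.-integrable I (EFin \o cst K).
  by apply: (@bounded_integrable_itv _ `|K|).
rewrite (le_trans (le_normr_Rintegral mI iF))//.
have -> : K * (b - a) = \int[mu]_(x in I) cst K x.
  rewrite Rintegral_cst//= lebesgue_measure_itv/=; congr (_ * _).
  rewrite lte_fin; case: ltP => [//|ba]; have -> : b = a; [by apply/eqP; rewrite eq_le ab ba|by rewrite subrr].
have iN : mu.-integrable I (EFin \o (fun x => `|F x|)).
  by apply: (bounded_integrable_itv (K := K)) => [|x /FK]; [exact: measurableT_comp|rewrite normr_id].
apply: (le_Rintegral mI iN iK) => x /=.
by rewrite in_itv/=; exact: FK.
Qed.

Lemma Rintegral_itv_cvg (F_ : nat -> R -> R) (F : R -> R) K :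
  (forall n, measurable_fun I (F_ n)) -> measurable_fun I F ->
  (forall n x, a <= x <= b -> `|F_ n x| <= K) ->
  {ae mu, forall x, a <= x <= b -> F_ n x @[n --> \oo] --> F x} ->
  \int[mu]_(x in I) F_ n x @[n --> \oo] --> \int[mu]_(x in I) F x.
Proof.
move=> mF_ mF FK Fcvg.
have iK : mu.-integrable I (EFin \o cst K) by apply: (@bounded_integrable_itv _ `|K|).
have m_ n : measurable_fun I (fun x => (F_ n x)%:E) by exact/measurable_EFinP.
have m : measurable_fun I (EFin \o F) by exact/measurable_EFinP.
have c : {ae mu, forall x, I x -> (F_ n x)%:E @[n --> \oo] --> (EFin \o F) x}.
  apply: (ae_imp Fcvg) => x H /=; rewrite in_itv/= => /H{}H.
  by apply: cvg_EFin => //; exact: nearW.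
have d : {ae mu, forall x, forall n : nat, I x -> (`|(F_ n x)%:E| <= (EFin \o cst K) x)%E}.
  by apply: aeW => x n /=; rewrite in_itv/= => /FK; rewrite lee_fin.
have [iF _ cvgF] := dominated_convergence mI m_ m c iK d.
apply: fine_cvg; rewrite fineK//.
exact: integrable_fin_num.
Qed.

End BoundedOnInterval.

Section RightDerivative.
Variables (g : R -> R) (r L : R).
Hypotheses (gc : convexR g) (gs : finite_conjugate g) (r0 : 0 <= r)
  (gL : speed_bound g r L).

Lemma hopf_lax_right_derivative (w : R -> R) x : lip r w -> derivable w x 1 ->
  (hopf_lax g w (harmonic n) x - w x) / harmonic n @[n --> \oo] --> - g (derive1 w x).
Proof.
move=> wr dw; have L0 := speed_bound_ge0 gc r0 gL.
have pr := lip_derive1_le x wr; set p := derive1 w x in pr *.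
have [q0 gq0] := subgrad_exists p gc.
have q0L : - L <= q0 <= L by apply: gL gq0; rewrite -ler_norml.
have g0E := fenchel_subgrad gs gq0.
apply/cvgrPdist_le => e e0.
have L1 : 0 < L + 1 by rewrite ltr_wpDl.
have e'0 : 0 < e / (L + 1) by rewrite divr_gt0.
have [d d0 Hd] := derivable_expansion dw e'0.
have d'0 : 0 < d / (L + 1) by rewrite divr_gt0.
have /cvgrPdist_lt/(_ _ d'0) := @cvg_harmonic R.
apply: filterS => n; set h := harmonic n; rewrite sub0r normrN => hd.
have h0 : 0 < h by rewrite invr_gt0.
move: hd; rewrite (gtr0_norm h0) ltr_pdivlMr// => hd.
have key q : - L <= q <= L -> `|w (x - h * q) - w x + h * q * p| <= e / (L + 1) * (h * L).
  rewrite -ler_norml => qL; have hqL : `|- (h * q)| <= h * L.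
    by rewrite normrN normrM (gtr0_norm h0) ler_wpM2l ?(ltW h0).
  have := Hd (- (h * q)); rewrite mulNr opprK [_ + x]addrC => H.
  rewrite (le_trans (H _)) ?ler_wpM2l ?(ltW e'0)//; nra.
have eL : e / (L + 1) * (h * L) <= e * h.
  rewrite mulrAC ler_pdivrMr// -!mulrA ler_wpM2l ?(ltW e0)//.
  by rewrite ler_wpM2l ?(ltW h0)//; lra.
have hw0 : hopf_lax g w h x <= w (x - h * q0) + h * fenchel g q0.
  exact: (hopf_lax_le gc gs r0 gL wr x q0 (ltW h0)).
have [q qL hwq] := hopf_lax_attained gc gs r0 gL wr x (ltW h0).
have /ler_normlP[_ k1] := key _ q0L; have /ler_normlP[k2 _] := key _ qL.
have yq := ler_wpM2l (ltW h0) (fenchel_young gs p q).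
suff : `|(- g p - (hopf_lax g w h x - w x) / h) * h| <= e * h.
  by rewrite normrM (gtr0_norm h0) ler_pM2r.
rewrite mulrBl mulrVK ?unitfE ?gt_eqF//.
rewrite ler_norml; rewrite g0E in hw0.
by apply/andP; split; lra.
Qed.

End RightDerivative.
End WeakFormulation.

Section TestFunctions.
Context {R : realType}.
Implicit Types phi : R * R -> R.

Lemma compact_support_zero phi (K : set (R * R)) : closed K ->
  (forall z, ~ K z -> phi z = 0) -> forall z, ~ K z -> Dx phi z = 0 /\ Dt phi z = 0.
Proof.
move=> cK phi0 z nKz.
have n0 : \forall w \near z, phi w = (cst 0 : R * R -> R) w.
  have : nbhs z (~` K) by apply: open_nbhs_nbhs; split=> //; exact: closed_openC.
  by apply: filterS => w /phi0.
by rewrite /Dx /Dt !(near_eq_derive _ n0) !derive_cst.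
Qed.

Lemma continuous_compact_support_bounded phi (K : set (R * R)) : compact K ->
  continuous phi -> (forall z, ~ K z -> phi z = 0) -> exists2 B, 0 <= B & forall z, `|phi z| <= B.
Proof.
move=> cK cphi phi0.
have [M [_ HM]] := compact_bounded (continuous_compact (continuous_subspaceT cphi) cK).
exists (`|M| + 1); first by rewrite addr_ge0.
move=> z; have [Kz|/phi0 ->] := pselect (K z); last by rewrite normr0 addr_ge0.
apply: (HM (`|M| + 1)); last by exists z.
by rewrite (le_lt_trans (ler_norm _))// ltrDl.
Qed.

Record test_data phi N B := TestData {
  td_Dx0 : forall z, N <= `|z.1| \/ N <= `|z.2| -> Dx phi z = 0;
  td_Dt0 : forall z, N <= `|z.1| \/ N <= `|z.2| -> Dt phi z = 0;
  td_0 : forall z, N <= `|z.1| \/ N <= `|z.2| -> phi z = 0;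
  td_Dx : forall z, `|Dx phi z| <= B;
  td_Dt : forall z, `|Dt phi z| <= B;
  td_cx : continuous (Dx phi);
  td_ct : continuous (Dt phi);
  td_c : continuous phi;
  td_dx : forall z, derivable phi z (1, 0);
  td_dt : forall z, derivable phi z (0, 1)
}.

Lemma test_functionP phi : test_function phi ->
  exists N B, [/\ 0 < N, 0 <= B & test_data phi N B].
Proof.
move=> [smooth cK]; set K := closure _ in cK.
have [c [dphi [cx _] [ct _]]] := smooth 1%N.
have {}c z : {for z, continuous phi} by exact: c.
have {}cx z : {for z, continuous (Dx phi)} by exact: cx.
have {}ct z : {for z, continuous (Dt phi)} by exact: ct.
have phi0 z : ~ K z -> phi z = 0.
  by move=> nK; apply/eqP/negPn/negP => z0; apply: nK; exact: subset_closure.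
have D0 := compact_support_zero (@closed_closure _ _) phi0.
have [B1 B10 HB1] := continuous_compact_support_bounded cK cx (fun z nK => (D0 z nK).1).
have [B2 B20 HB2] := continuous_compact_support_bounded cK ct (fun z nK => (D0 z nK).2).
have [M [_ HM]] := compact_bounded cK.
pose N := `|M| + 2.
have out z : N <= `|z.1| \/ N <= `|z.2| -> ~ K z.
  move=> Nz Kz; have MM : M < `|M| + 1 by rewrite (le_lt_trans (ler_norm _))// ltrDl.
  have : Num.max `|z.1| `|z.2| <= `|M| + 1 := HM _ MM z Kz.
  rewrite ge_max => /andP[h1 h2].
  by case: Nz; rewrite /N; lra.
exists N, (Num.max B1 B2); split.
- by rewrite ltr_wpDl.
- by rewrite le_max B10.
- constructor.
  + by move=> z /out nK; exact: (D0 z nK).1.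
  + by move=> z /out nK; exact: (D0 z nK).2.
  + by move=> z /out nK; exact: phi0.
  + by move=> z; rewrite le_max HB1.
  + by move=> z; rewrite le_max HB2 orbT.
  + exact: cx.
  + exact: ct.
  + exact: c.
  + by move=> z; exact: (dphi z Logic.I).1.
  + by move=> z; exact: (dphi z Logic.I).2.
Qed.

Lemma lip_of_derivable (F : R -> R) B : (forall x, derivable F x 1 /\ `|derive1 F x| <= B) -> lip B F.
Proof.
move=> H x y; have := @mvt_bound R F y x 0 B; rewrite mul0r subr0; apply=> c _.
by rewrite subr0.
Qed.

End TestFunctions.

Section WeakSolution.
Context {R : realType}.
Local Notation mu := (@lebesgue_measure R).
Variables (V : R -> R -> R) (f : R -> R) (k C : R).
Hypotheses (Vk : forall t, 0 <= t -> lip k (V ^~ t)) (C0 : 0 <= C)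
  (VC : forall x t h, 0 <= t -> 0 <= h -> `|V x (t + h) - V x t| <= C * h)
  (Vrd : forall x t, 0 <= t -> derivable (V ^~ t) x 1 ->
     (V x (t + harmonic n) - V x t) / harmonic n @[n --> \oo] --> - f (derive1 (V ^~ t) x))
  (fc : continuous f).
Variables (phi : R * R -> R) (N B : R).
Hypotheses (N0 : 0 < N) (B0 : 0 <= B) (P : test_data phi N B).

Local Notation I := (`[- N, N]%classic : set (measurableTypeR R)).
Let u x t := derive1 (V ^~ t) x.

Let k0 : 0 <= k. Proof. exact: lip_ge0 (Vk (lexx 0)). Qed.

Let cslice (F : R * R -> R) t : continuous F -> continuous (fun x => F (x, t)).
Proof.
move=> cF x; apply: (@continuous_comp _ _ _ (fun x : R => (x, t)) F); last exact: cF.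
have := @cvg_pair R R R (nbhs x) (nbhs x) (nbhs t) _ _ _ id (cst t)
  (@cvg_id _ _) (@cvg_cst _ _ _ _ _).
exact.
Qed.

Let mslice (F : R * R -> R) t : continuous F -> measurable_fun I (fun x => F (x, t)).
Proof. by move=> cF; apply: measurable_funTS; apply: continuous_measurable_fun; exact: cslice. Qed.

Let mV t : 0 <= t -> measurable_fun I (V ^~ t).
Proof.
move=> t0; apply: measurable_funTS; apply: continuous_measurable_fun.
exact: lip_continuous (Vk t0).
Qed.

Let mI : measurable I. Proof. exact: measurable_itv. Qed.

Let mu_ t : 0 <= t -> measurable_fun I (u ^~ t).
Proof. by move=> t0; exact: lip_measurable_derive1 (Vk t0) _. Qed.

Let uk x t : 0 <= t -> `|u x t| <= k.
Proof. by move=> t0; exact: lip_derive1_le (Vk t0). Qed.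

Let phi_lip t : lip B (fun x => phi (x, t)).
Proof.
apply: lip_of_derivable => x; have [dx ->] := slice_x (@td_dx _ _ _ _ P (x, t)).
by split=> //; exact: (td_Dx P).
Qed.

Let phi_lip_t x : lip B (fun t => phi (x, t)).
Proof.
apply: lip_of_derivable => t; have [dx ->] := slice_t (@td_dt _ _ _ _ P (x, t)).
by split=> //; exact: (td_Dt P).
Qed.

Definition moment t := \int[mu]_(x in I) (V x t * Dx phi (x, t)).
Definition flux_term t := \int[mu]_(x in I) (u x t * Dt phi (x, t) + f (u x t) * Dx phi (x, t)).

Let VA t : 0 <= t -> exists A, forall x, - N <= x <= N -> `|V x t| <= A.
Proof.
move=> t0; exists (`|V 0 t| + k * N) => x; rewrite -ler_norml => xN.
rewrite -[V x t](subrK (V 0 t)) (le_trans (ler_normD _ _))// addrC lerD2l.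
by rewrite (le_trans (Vk t0 _ _))// subr0 ler_wpM2l.
Qed.

Let iVF t (F : R * R -> R) s : 0 <= t -> continuous F -> (forall z, `|F z| <= B) ->
  mu.-integrable I (EFin \o (fun x => V x t * F (x, s))).
Proof.
move=> t0 cF FB; have [A HA] := VA t0.
apply: (@bounded_integrable_itv _ _ _ _ (A * B)).
  by apply: measurable_funM; [exact: mV|exact: mslice].
by move=> x xN; rewrite normrM ler_pM// HA.
Qed.

(* Moving the time increment of [Dx phi] to [phi] by parts avoids mixed second
   derivatives of [phi]. *)
Let moment_increment t h : 0 <= t -> 0 <= h ->
  moment (t + h) - moment t =
  \int[mu]_(x in I) ((V x (t + h) - V x t) * Dx phi (x, t + h)) -
  \int[mu]_(x in I) (u x t * (phi (x, t + h) - phi (x, t))).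
Proof.
have gen (a b c d : R) : d + (b - c) = 0 -> a - c = a - b - d by lra.
move=> t0 h0; have th0 := addr_ge0 t0 h0.
have cx := @td_cx _ _ _ _ P; have bx := @td_Dx _ _ _ _ P.
pose psi x := phi (x, t + h) - phi (x, t).
have psiL : lip (B + B) psi.
  move=> x y; rewrite (_ : psi x - psi y = (phi (x, t + h) - phi (y, t + h)) - (phi (x, t) - phi (y, t))); last first.
    by rewrite /psi; ring.
  rewrite (le_trans (ler_normB _ _))// mulrDl lerD//.
    exact: (phi_lip (t + h)).
  exact: (phi_lip t).
have psi0 x : N <= `|x| -> psi x = 0.
  by move=> Nx; rewrite /psi !(td_0 P) ?subrr//=; left.
have dpsi x : derive1 psi x = Dx phi (x, t + h) - Dx phi (x, t).
  have [d1 e1] := slice_x (@td_dx _ _ _ _ P (x, t + h)); have [d2 e2] := slice_x (@td_dx _ _ _ _ P (x, t)).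
  rewrite -e1 -e2 !derive1E; exact: (deriveB d1 d2).
have := integral_lip_mul (ltW N0) (Vk t0) psiL psi0.
have i1 : mu.-integrable I (EFin \o (fun x => u x t * psi x)).
  apply: (@bounded_integrable_itv _ _ _ _ (k * ((B + B) * (N + N)))).
    apply: measurable_funM; first exact: mu_.
    by apply: measurable_funTS; apply: continuous_measurable_fun; exact: lip_continuous psiL.
  move=> x; rewrite -ler_norml => xN; rewrite normrM ler_pM ?uk//.
  have psiN : psi N = 0 by rewrite psi0// (ger0_norm (ltW N0)).
  have := psiL x N; rewrite psiN subr0 => /le_trans; apply.
  by rewrite ler_wpM2l ?addr_ge0// (le_trans (ler_normB _ _))// lerD// gtr0_norm.
have i2 : mu.-integrable I (EFin \o (fun x => V x t * Dx phi (x, t + h))) by exact: iVF.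
have i3 : mu.-integrable I (EFin \o (fun x => V x t * Dx phi (x, t))) by exact: iVF.
have i4 : mu.-integrable I (EFin \o (fun x => V x (t + h) * Dx phi (x, t + h))) by exact: iVF.
rewrite (@eq_Rintegral _ _ _ mu I (fun x => u x t * psi x + (V x t * Dx phi (x, t + h) - V x t * Dx phi (x, t)))); last first.
  by move=> x _; congr (_ + _); rewrite dpsi mulrBr.
rewrite RintegralD//; last first.
  exact: (integrableB mI i2 i3).
rewrite RintegralB// => E.
rewrite (@eq_Rintegral _ _ _ mu I (fun x => V x (t + h) * Dx phi (x, t + h) - V x t * Dx phi (x, t + h))
  (fun x => (V x (t + h) - V x t) * _)); last by move=> x _; rewrite mulrBl.
rewrite RintegralB//.
exact: gen E.
Qed.


Let NN : - N <= N. Proof. by rewrite (le_trans _ (ltW N0))// oppr_le0 ltW. Qed.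

Let m_dV t h : 0 <= t -> 0 <= h ->
  measurable_fun I (fun x => (V x (t + h) - V x t) * Dx phi (x, t + h)).
Proof.
move=> t0 h0; apply: measurable_funM; last exact: (mslice _ (td_cx P)).
by apply: measurable_funB; apply: mV => //; exact: addr_ge0.
Qed.

Let m_dphi t h : 0 <= t ->
  measurable_fun I (fun x => u x t * (phi (x, t + h) - phi (x, t))).
Proof.
move=> t0; apply: measurable_funM; first exact: mu_.
by apply: measurable_funB; exact: (mslice _ (td_c P)).
Qed.

Let b_dV t h x : 0 <= t -> 0 <= h -> `|(V x (t + h) - V x t) * Dx phi (x, t + h)| <= C * B * h.
Proof.
move=> t0 h0; rewrite normrM mulrAC ler_pM//; first exact: VC.
exact: (td_Dx P).
Qed.

Let b_dphi t h x : 0 <= t -> 0 <= h -> `|u x t * (phi (x, t + h) - phi (x, t))| <= k * B * h.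
Proof.
move=> t0 h0; rewrite normrM -mulrA ler_pM ?uk//.
by have := phi_lip_t x (t + h) t; rewrite addrAC subrr add0r (ger0_norm h0).
Qed.

Let K := (C * B + k * B) * (N - - N).

Let moment_lip_side t h : 0 <= t -> 0 <= h -> `|moment (t + h) - moment t| <= K * h.
Proof.
move=> t0 h0; rewrite moment_increment// (le_trans (ler_normB _ _))//.
have A := Rintegral_itv_le NN (m_dV t0 h0) (fun x _ => b_dV x t0 h0).
have A' := Rintegral_itv_le NN (m_dphi h t0) (fun x _ => b_dphi x t0 h0).
by rewrite (le_trans (lerD A A'))// /K -!mulrDl mulrAC.
Qed.

Let moment_lip : lip K (fun t => moment (Num.max t 0)).
Proof.
have side s t : s <= t -> `|moment (Num.max t 0) - moment (Num.max s 0)| <= K * `|t - s|.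
  move=> st; have st' : Num.max s 0 <= Num.max t 0 by rewrite ge_max !le_max st lexx orbT.
  have K0 : 0 <= K by rewrite mulr_ge0 ?subr_ge0// addr_ge0 ?mulr_ge0.
  have := @moment_lip_side (Num.max s 0) (Num.max t 0 - Num.max s 0).
  rewrite (addrC (Num.max s 0)) subrK le_max lexx orbT subr_ge0 => /(_ isT st')/le_trans; apply.
  rewrite ler_wpM2l// (ger0_norm (x := t - s)) ?subr_ge0//.
  by case: (leP s 0); case: (leP t 0); lra.
move=> x y; have [xy|/ltW yx] := leP x y; last exact: side.
by rewrite distrC (distrC x) side.
Qed.

Let f_bound : exists M, forall p, `|p| <= k -> `|f p| <= M.
Proof.
have [M [_ HM]] := compact_bounded (continuous_compact
  (continuous_subspaceT fc) (@segment_compact _ (- k) k)).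
exists (`|M| + 1) => p; rewrite ler_norml => pk.
apply: (HM (`|M| + 1)); last by exists p.
by rewrite (le_lt_trans (ler_norm _))// ltrDl.
Qed.

Let moment_right_derivative t : 0 <= t ->
  quotient moment t (harmonic n) @[n --> \oo] --> - flux_term t.
Proof.
move=> t0; pose h n : R := harmonic n.
have h0 n : 0 < h n by rewrite invr_gt0.
have hge n := ltW (h0 n).
have hV n : (h n)^-1 * h n = 1 by rewrite mulVf// gt_eqF.
pose a n x := (h n)^-1 * ((V x (t + h n) - V x t) * Dx phi (x, t + h n)).
pose b n x := (h n)^-1 * (u x t * (phi (x, t + h n) - phi (x, t))).
have iE n : quotient moment t (h n) = \int[mu]_(x in I) a n x - \int[mu]_(x in I) b n x.
  rewrite /quotient (addrC (h n)) moment_increment// mulrBr -!RintegralZl//.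
    by apply: bounded_integrable_itv (m_dphi _ t0) (fun x _ => b_dphi x t0 (hge n)).
  by apply: bounded_integrable_itv (m_dV t0 (hge n)) (fun x _ => b_dV x t0 (hge n)).
have ma n : measurable_fun I (a n) by apply: measurable_funM => //; exact: m_dV.
have mb n : measurable_fun I (b n) by apply: measurable_funM => //; exact: m_dphi.
have mfu : measurable_fun I (fun x => - f (u x t) * Dx phi (x, t)).
  apply: measurable_funM; last exact: (mslice _ (td_cx P)).
  apply: measurableT_comp => //; apply: (measurableT_comp (f := f)); last exact: mu_.
  exact: continuous_measurable_fun.
have mut : measurable_fun I (fun x => u x t * Dt phi (x, t)).
  by apply: measurable_funM; [exact: mu_|exact: (mslice _ (td_ct P))].
have ab n x : `|a n x| <= C * B.
  rewrite /a normrM (ger0_norm (x := (h n)^-1)) ?invr_ge0//.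
  by rewrite mulrC ler_pdivrMr// b_dV.
have bb n x : `|b n x| <= k * B.
  rewrite /b normrM (ger0_norm (x := (h n)^-1)) ?invr_ge0//.
  by rewrite mulrC ler_pdivrMr// b_dphi.
have ca : {ae mu, forall x, - N <= x <= N -> a n x @[n --> \oo] --> - f (u x t) * Dx phi (x, t)}.
  apply: (ae_imp (lip_ae_derivable (Vk t0))) => x dV _.
  rewrite (_ : a ^~ x = fun n => ((V x (t + h n) - V x t) / h n) * Dx phi (x, t + h n)); last first.
    by apply/funext => n; rewrite /a mulrA (mulrC (h n)^-1).
  apply: cvgM; first exact: Vrd.
  have ct : t + h n @[n --> \oo] --> t.
    by rewrite -[in X in _ --> X](addr0 t); apply: cvgD; [exact: cvg_cst|exact: cvg_harmonic].
  have cp : (x, t + h n) @[n --> \oo] --> (x, t).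
    exact: (@cvg_pair nat R R \oo (nbhs x) (nbhs t) _ _ _ (cst x) (fun n => t + h n) (@cvg_cst _ _ _ _ _) ct).
  exact: (cvg_comp _ (Dx phi) cp (@td_cx _ _ _ _ P (x, t))).
have cb : {ae mu, forall x, - N <= x <= N -> b n x @[n --> \oo] --> u x t * Dt phi (x, t)}.
  apply: aeW => x _.
  rewrite (_ : b ^~ x = fun n => u x t * quotient (fun s => phi (x, s)) t (harmonic n)); last first.
    by apply/funext => n; rewrite /b /quotient mulrCA (addrC (h n)).
  apply: cvgM; first exact: cvg_cst.
  have := slice_t (@td_dt _ _ _ _ P (x, t)).
  by move=> /(lip_derivableP t (Dt phi (x, t)) (phi_lip_t x)).1[].
have [Bf HBf] := f_bound.
have iut : mu.-integrable I (EFin \o (fun x => u x t * Dt phi (x, t))).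
  apply: (bounded_integrable_itv (K := k * B) mut) => x _.
  by rewrite normrM ler_pM ?uk//; exact: (td_Dt P).
have ifu : mu.-integrable I (EFin \o (fun x => - f (u x t) * Dx phi (x, t))).
  apply: (bounded_integrable_itv (K := Bf * B) mfu) => x _.
  by rewrite normrM normrN ler_pM ?HBf ?uk//; exact: (td_Dx P).
have ifu' : mu.-integrable I (EFin \o (fun x => u x t * Dt phi (x, t) + f (u x t) * Dx phi (x, t))).
  have := integrableB mI iut ifu; apply: eq_integrable => // x _ /=.
  by rewrite -EFinB mulNr opprK.
have -> : - flux_term t = \int[mu]_(x in I) (- f (u x t) * Dx phi (x, t)) -
    \int[mu]_(x in I) (u x t * Dt phi (x, t)).
  rewrite -RintegralB// -[LHS]mulN1r -RintegralZl//; apply: eq_Rintegral => x _.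
  by ring.
have -> : (fun n => quotient moment t (harmonic n)) =
    (fun n => \int[mu]_(x in I) a n x - \int[mu]_(x in I) b n x).
  by apply/funext => n; rewrite -iE.
exact: cvgB (Rintegral_itv_cvg ma mfu (fun n x _ => ab n x) ca)
  (Rintegral_itv_cvg mb mut (fun n x _ => bb n x) cb).
Qed.

Lemma weak_identity : \int[mu]_(t in `]0, +oo[) flux_term t = moment 0.
Proof.
pose F t := moment (Num.max t 0).
have F_moment t : 0 <= t -> F t = moment t by move=> t0; rewrite /F max_l.
have F_lip : lip K F by exact: moment_lip.
clearbody F.
have qF t : 0 <= t -> quotient F t (harmonic n) @[n --> \oo] --> - flux_term t.
  move=> t0; have -> : (fun n => quotient F t (harmonic n)) = (fun n => quotient moment t (harmonic n)).
    apply/funext => n; rewrite /quotient !F_moment// addr_ge0//.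
    by rewrite invr_ge0.
  exact: moment_right_derivative.
have dF t : 0 <= t -> derivable F t 1 -> flux_term t = - derive1 F t.
  move=> t0 dF; have [hp _] := (lip_derivableP t (derive1 F t) F_lip).1 (conj dF erefl).
  by rewrite -(cvg_unique (@Rhausdorff R) (qF t t0) hp) opprK.
have flux0 t : N <= t -> flux_term t = 0.
  move=> Nt; rewrite /flux_term (@eq_Rintegral _ _ _ mu I (cst 0)); first by rewrite Rintegral_cst// mul0r.
  have tt : N <= `|t| by rewrite (le_trans Nt)// ler_norm.
  by move=> x _; rewrite (td_Dt0 P) ?(td_Dx0 P) ?mulr0 ?addr0//=; right.
have moment0 : moment N = 0.
  rewrite /moment (@eq_Rintegral _ _ _ mu I (cst 0)); first by rewrite Rintegral_cst// mul0r.
  by move=> x _; rewrite (td_Dx0 P) ?mulr0//=; right; rewrite ler_norm.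
pose J := `]0, +oo[%classic : set (measurableTypeR R).
have mJ : measurable J by exact: measurable_itv.
pose J' := `]0, N]%classic : set (measurableTypeR R).
have mJ' : measurable J' by exact: measurable_itv.
have mdF : measurable_fun J' (fun t => - derive1 F t).
  by apply: measurableT_comp => //; exact: lip_measurable_derive1 F_lip _.
have mflux : measurable_fun J flux_term.
  apply: (@measurable_fun_cvg _ _ _ J (fun n t => - quotient F t (harmonic n))) => [n|t].
    have mF : measurable_fun setT F.
      exact: continuous_measurable_fun (lip_continuous F_lip).
    apply: measurable_funTS; apply: measurableT_comp => //; rewrite /quotient.
    apply: measurable_funM; first exact: measurable_cst.
    apply: measurable_funB; last exact: mF.
    apply: (measurableT_comp mF); apply: measurable_funD; first exact: measurable_cst.
    exact: measurable_id.
  rewrite /J/= in_itv/= andbT => /ltW t0.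
  by rewrite -[flux_term t]opprK; apply: cvgN; exact: qF.
have idF : mu.-integrable `[0, N] (EFin \o derive1 F).
  exact: lip_integrable_derive1 F_lip.
have idF' : mu.-integrable J' (EFin \o derive1 F).
  by apply: integrableS idF => //; apply: subset_itv; rewrite bnd_simp.
transitivity (\int[mu]_(t in J') (- derive1 F t)); last first.
  under eq_Rintegral do rewrite -mulN1r.
  rewrite RintegralZl// Rintegral_itv_obnd_cbnd// (lip_FTC F_lip) ?(ltW N0)//.
  by rewrite !F_moment ?(ltW N0)// moment0 sub0r mulN1r opprK.
rewrite [LHS]Rintegral_mkcond [RHS]Rintegral_mkcond.
rewrite /Rintegral; congr fine; apply: ae_eq_integral => //.
- by apply/measurable_EFinP; apply/(measurable_restrictT _ mJ).
- by apply/measurable_EFinP; apply/(measurable_restrictT _ mJ').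
apply: (ae_imp (lip_ae_derivable F_lip)) => t dFt _; congr EFin.
rewrite !patchE !mem_setE /J /J' !in_itv/= andbT; case: ltP => //= t0.
have [tN|Nt] := leP t N; first exact: dF (ltW t0) dFt.
exact/flux0/ltW.
Qed.

End WeakSolution.

(** * Contraction *)

Section Contraction.
Context {R : realType}.
Local Notation mu := (@lebesgue_measure R).
Implicit Types (x y t k : R) (W Phi : R -> R).

Section VariationIntegral.
Variables (W Phi : R -> R) (k a b : R).
Hypotheses (Wk : lip k W) (ab : a <= b)
  (WPhi : forall x y, x <= y -> `|W y - W x| <= Phi y - Phi x).

Let Phi_nd x y : x <= y -> Phi x <= Phi y.
Proof. by move=> /WPhi/(le_trans (normr_ge0 _)); rewrite subr_ge0. Qed.

(* The largest [k]-Lipschitz minorant of [Phi] on [a, +oo[, extended by a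
   constant; it still controls the increments of [W]. *)
Let S x := [set Phi y + k * (Num.max a x - y) | y in `[a, Num.max a x]].
Let Psi x := inf (S x).

Let S0 x : S x !=set0.
Proof.
exists (Phi a + k * (Num.max a x - a)), a => //=.
by rewrite in_itv/= lexx le_max lexx.
Qed.

Let Slb x : lbound (S x) (Phi a).
Proof.
move=> _ [y /= + <-]; rewrite in_itv/= => /andP[ay yx].
by rewrite (le_trans (Phi_nd ay))// lerDl mulr_ge0 ?subr_ge0// (lip_ge0 Wk).
Qed.

Let Psi_le x y : a <= y <= Num.max a x -> Psi x <= Phi y + k * (Num.max a x - y).
Proof.
move=> ayx; apply: ge_inf; first by exists (Phi a); exact: Slb.
by exists y => //=; rewrite in_itv.
Qed.

Let max_le x y : x <= y -> Num.max a x <= Num.max a y.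
Proof. by move=> xy; rewrite ge_max !le_max lexx xy orbT. Qed.

Let Psi_W x y : x <= y -> `|W (Num.max a y) - W (Num.max a x)| <= Psi y - Psi x.
Proof.
move=> xy; have XY := max_le xy; rewrite lerBrDl.
set X := Num.max a x in XY *; set Y := Num.max a y in XY *.
have aX : a <= X by rewrite le_max lexx.
apply: lb_le_inf => // _ [z /= + <-]; rewrite in_itv/= -/Y => /andP[az zY].
have [zX|/ltW Xz] := leP z X.
  have := @Psi_le x z; rewrite az -/X zX => /(_ isT) h.
  have := Wk Y X; rewrite (ger0_norm (x := Y - X)) ?subr_ge0//; lra.
have := @Psi_le x X; rewrite aX -/X lexx subrr mulr0 => /(_ isT) h.
have h1 := WPhi Xz; have := Wk Y z; rewrite (ger0_norm (x := Y - z)) ?subr_ge0// => h2.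
have := ler_normD (W Y - W z) (W z - W X); rewrite addrA subrK; lra.
Qed.

Let Psi_lip : lip k Psi.
Proof.
have side x y : x <= y -> `|Psi y - Psi x| <= k * `|y - x|.
  move=> xy; have XY := max_le xy.
  rewrite ger0_norm; last by apply: le_trans (Psi_W xy).
  rewrite lerBlDl -lerBlDr; apply: lb_le_inf => // _ [z /= + <-]; rewrite in_itv/= => /andP[az zX].
  have := @Psi_le y z; rewrite az (le_trans zX)//= => /(_ isT) h.
  have : k * (Num.max a y - Num.max a x) <= k * `|y - x|.
    rewrite ler_wpM2l ?(lip_ge0 Wk)// ger0_norm ?subr_ge0//.
    by case: (leP a y); case: (leP a x); lra.
  lra.
move=> x y; have [xy|/ltW yx] := leP x y; last exact: side.
by rewrite distrC (distrC x) side.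
Qed.

Lemma integral_norm_derive_le :
  \int[mu]_(x in `[a, b]) `|derive1 W x| <= Phi b - Phi a.
Proof.
have Psia : Phi a <= Psi a by apply: lb_le_inf => //; exact: Slb.
have Psib : Psi b <= Phi b.
  have := @Psi_le b b; rewrite ab (max_r ab) lexx subrr mulr0 addr0; exact.
have abs_int : mu.-integrable `[a, b] (EFin \o (fun x => `|derive1 W x|)).
  have := integrable_abse (lip_integrable_derive1 a b Wk).
  by apply: eq_integrable => //; exact: measurable_itv.
apply: (@le_trans _ _ (Psi b - Psi a)); last by rewrite lerB.
rewrite -(lip_FTC Psi_lip ab).
have mab : measurable (`[a, b]%classic : set (measurableTypeR R)) by exact: measurable_itv.
rewrite /Rintegral fine_le//.
- exact: integrable_fin_num abs_int.
- by apply: integrable_fin_num => //; exact: lip_integrable_derive1 Psi_lip.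
apply: ae_ge0_le_integral => //.
- by have /measurable_int := abs_int.
- move=> x _; rewrite lee_fin.
  have [dP|ndP] := pselect (derivable Psi x 1); last first.
    by rewrite derive1_nondiff.
  have [hp _] := (lip_derivableP x _ Psi_lip).1 (conj dP erefl).
  apply: (cvgr_to_ge hp); apply: nearW => n; rewrite /quotient mulr_ge0 ?invr_ge0//.
  have hx : x <= harmonic n + x by rewrite lerDr invr_ge0.
  exact: le_trans (Psi_W hx).
- by apply/measurable_EFinP; exact: lip_measurable_derive1 Psi_lip _.
apply: (ae_imp (ae_and (lip_ae_derivable Wk) (lip_ae_derivable Psi_lip))) => x [dW dP].
rewrite /= in_itv/= => /andP[ax xb]; rewrite lee_fin.
have [hW _] := (lip_derivableP x _ Wk).1 (conj dW erefl).
have [hP _] := (lip_derivableP x _ Psi_lip).1 (conj dP erefl).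
apply: (ler_cvg_to (cvg_norm hW) hP); apply: nearW => n.
have hx : x <= harmonic n + x by rewrite lerDr invr_ge0.
have := Psi_W hx; rewrite !max_r ?(le_trans ax hx)// => H.
by rewrite /quotient normrM ger0_norm ?invr_ge0// ler_wpM2l// invr_ge0 invr_ge0.
Qed.

End VariationIntegral.

Section HopfLaxContraction.
Variables (g : R -> R) (r L : R) (v1 v2 Gp : R -> R).
Hypotheses (gc : convexR g) (gs : finite_conjugate g) (r0 : 0 <= r)
  (gL : speed_bound g r L) (v1r : lip r v1) (v2r : lip r v2)
  (vG : forall x y, x <= y -> `|(v1 y - v2 y) - (v1 x - v2 x)| <= Gp y - Gp x).

Lemma hopf_lax_increments t : 0 < t -> exists Phi : R -> R,
  (forall x y, x <= y ->
    `|(hopf_lax g v1 t y - hopf_lax g v2 t y) - (hopf_lax g v1 t x - hopf_lax g v2 t x)|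
      <= Phi y - Phi x) /\
  (forall x, Gp (x - L * t) <= Phi x <= Gp (x + L * t)).
Proof.
move=> t0; have [Y1 [Y1_nd Y1b Y1E]] := monotone_minimizers gc gs r0 gL v1r t0.
have [Y2 [Y2_nd Y2b Y2E]] := monotone_minimizers gc gs r0 gL v2r t0.
pose V1 := hopf_lax g v1 t; pose V2 := hopf_lax g v2 t.
pose W x := V1 x - V2 x; pose w y := v1 y - v2 y.
pose c x y := t * fenchel g ((x - y) / t).
have V1le x y : V1 x <= v1 y + c x y by exact: (hopf_lax_le_pt gc gs r0 gL).
have V2le x y : V2 x <= v2 y + c x y by exact: (hopf_lax_le_pt gc gs r0 gL).
have V1E x : V1 x = v1 (Y1 x) + c x (Y1 x) by exact: Y1E.
have V2E x : V2 x = v2 (Y2 x) + c x (Y2 x) by exact: Y2E.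
have unc x x' y y' : x <= x' -> y' <= y -> c x y' + c x' y <= c x y + c x' y'.
  by move=> xx' yy'; exact: fenchel_uncross.
have Gw x y : x <= y -> Gp x - w x <= Gp y - w y /\ Gp x + w x <= Gp y + w y.
  by move=> /vG/ler_normlP[]; rewrite -/(w y) -/(w x) => h1 h2; split; lra.
have Gnd x y : x <= y -> Gp x <= Gp y by move=> /Gw[]; lra.
have Wle x : W x <= w (Y2 x) by have := V1le x (Y2 x); rewrite /W /w V2E; lra.
have Wge x : w (Y1 x) <= W x by have := V2le x (Y1 x); rewrite /W /w V1E; lra.
(* If the minimizers cross, exchanging them costs nothing. *)
have cross1 x x' : x <= x' -> Y2 x' <= Y1 x -> W x' <= W x.
  move=> xx' /(unc _ _ _ _ xx') U; have := V1le x' (Y1 x); have := V2le x (Y2 x').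
  by rewrite /W (V1E x) (V2E x'); lra.
have cross2 x x' : x <= x' -> Y1 x' <= Y2 x -> W x <= W x'.
  move=> xx' /(unc _ _ _ _ xx') U; have := V2le x' (Y2 x); have := V1le x (Y1 x').
  by rewrite /W (V2E x) (V1E x'); lra.
(* [P1] and [P2] transport [Gp] along the two minimizers; the corrections make both
   [min P1 P2 + W] and [min P1 P2 - W] nondecreasing. *)
pose P1 x := Gp (Y1 x) - w (Y1 x) + W x.
pose P2 x := Gp (Y2 x) + w (Y2 x) - W x.
exists (fun x => Num.min (P1 x) (P2 x)); split.
  move=> x x' xx'; rewrite -/(W x) -/(W x') ler_norml.
  have [a1 _] := Gw _ _ (Y1_nd _ _ xx'); have [_ a2] := Gw _ _ (Y2_nd _ _ xx').
  have b1 := Wle x'; have b2 := Wge x'.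
  set m := Num.min (P1 x) (P2 x).
  have m1 : m <= Gp (Y1 x) - w (Y1 x) + W x by rewrite ge_min lexx.
  have m2 : m <= Gp (Y2 x) + w (Y2 x) - W x by rewrite ge_min lexx orbT.
  have up : m + (W x' - W x) <= Num.min (P1 x') (P2 x').
    rewrite le_min /P1 /P2; apply/andP; split; first lra.
    have [yy|/ltW yy] := leP (Y1 x) (Y2 x'); first by have [h _] := Gw _ _ yy; lra.
    by have := cross1 _ _ xx' yy; lra.
  have dn : m - (W x' - W x) <= Num.min (P1 x') (P2 x').
    rewrite le_min /P1 /P2; apply/andP; split; last lra.
    have [yy|/ltW yy] := leP (Y2 x) (Y1 x'); first by have [_ h] := Gw _ _ yy; lra.
    by have := cross2 _ _ xx' yy; lra.
  by apply/andP; split; lra.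
move=> x; have b1 := Wle x; have b2 := Wge x.
have c1 := Y1b x; have c2 := Y2b x.
apply/andP; split.
  rewrite le_min; apply/andP; split.
    by have := @Gnd (x - L * t) (Y1 x) ltac:(lra); rewrite /P1; lra.
  by have := @Gnd (x - L * t) (Y2 x) ltac:(lra); rewrite /P2; lra.
rewrite ge_min; apply/orP; have [yy|/ltW yy] := leP (Y1 x) (Y2 x); [left|right].
  have [h _] := Gw _ _ yy; have := @Gnd (Y2 x) (x + L * t) ltac:(lra).
  by rewrite /P1; lra.
have [_ h] := Gw _ _ yy; have := @Gnd (Y1 x) (x + L * t) ltac:(lra).
by rewrite /P2; lra.
Qed.

Lemma hopf_lax_contraction t a b : 0 < t -> a <= b ->
  \int[mu]_(x in `[a, b]) `|derive1 (hopf_lax g v1 t) x - derive1 (hopf_lax g v2 t) x| <=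
  Gp (b + L * t) - Gp (a - L * t).
Proof.
move=> t0 ab; have [Phi [inc bnd]] := hopf_lax_increments t0.
have l1 := hopf_lax_lip gc gs r0 gL v1r (ltW t0) v1r.
have l2 := hopf_lax_lip gc gs r0 gL v2r (ltW t0) v2r.
pose W x := hopf_lax g v1 t x - hopf_lax g v2 t x.
have Wl : lip (r + r) W.
  move=> x y; rewrite (_ : W x - W y = (hopf_lax g v1 t x - hopf_lax g v1 t y) -
    (hopf_lax g v2 t x - hopf_lax g v2 t y)); last by rewrite /W; ring.
  by rewrite (le_trans (ler_normB _ _))// mulrDl lerD.
have := integral_norm_derive_le Wl ab inc.
have /andP[_ +] := bnd b; have /andP[+ _] := bnd a => ha hb hI.
apply: (@le_trans _ _ (Phi b - Phi a)); last by rewrite lerB.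
apply: le_trans hI; rewrite le_eqVlt; apply/orP; left; apply/eqP.
have mab : measurable (`[a, b]%classic : set (measurableTypeR R)) by exact: measurable_itv.
rewrite /Rintegral; congr fine; apply: ae_eq_integral => //.
- apply/measurable_EFinP; apply: measurableT_comp => //.
  by apply: measurable_funB; [exact: lip_measurable_derive1 l1 _|exact: lip_measurable_derive1 l2 _].
- apply/measurable_EFinP; apply: measurableT_comp => //.
  exact: lip_measurable_derive1 Wl _.
apply: (ae_imp (ae_and (lip_ae_derivable l1) (lip_ae_derivable l2))) => x [d1 d2] _.
by congr (`|_|%:E); rewrite !derive1E; rewrite -deriveB.
Qed.

End HopfLaxContraction.
End Contraction.

(** * Primitives of essentially bounded functions *)

Section Primitive.
Context {R : realType}.
Local Notation mu := (@lebesgue_measure R).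
Implicit Types x y a b : R.

Lemma lebesgue_setT_gt0 : (0 < mu setT)%E.
Proof.
apply: (@lt_le_trans _ _ (mu `[0, 1])); last first.
  by apply: le_measure; rewrite ?inE//; exact: measurable_itv.
by rewrite lebesgue_measure_itv/= lte_fin ltr01 -EFinB lte_fin subr0.
Qed.

Lemma Linfty_normP (u0 : R -> R) : u0 \in Lfun mu +oo%E ->
  [/\ measurable_fun setT u0, 0 <= fine (Linfty_norm u0),
      Linfty_norm u0 = (fine (Linfty_norm u0))%:E &
      {ae mu, forall x, `|u0 x| <= fine (Linfty_norm u0)}].
Proof.
move=> /andP[]; rewrite !inE => /= mu0 Nfin.
have N0 : (0 <= Linfty_norm u0)%E by exact: Lnorm_ge0.
have Nf : Linfty_norm u0 \is a fin_num.
  by rewrite ge0_fin_numE//; move: Nfin; rewrite /finLfun /finite_norm inE.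
split=> //; first exact: fine_ge0; first by rewrite fineK.
have := ess_sup_ge mu (abse \o (EFin \o u0)) => /ae_imp; apply=> x /= H.
rewrite -lee_fin fineK//; apply: le_trans H _.
by rewrite /Linfty_norm unlock/= lebesgue_setT_gt0.
Qed.

Variables (u0 : R -> R) (M : R).
Hypotheses (mu0 : measurable_fun setT u0) (M0 : 0 <= M)
  (u0M : {ae mu, forall x, `|u0 x| <= M}).

Lemma integral_bounded_itv (c d : bool) a b :
  mu.-integrable [set` Interval (BSide c a) (BSide d b)] (EFin \o u0) /\
  (\int[mu]_(x in [set` Interval (BSide c a) (BSide d b)]) `|(u0 x)%:E| <=
   M%:E * mu [set` Interval (BSide c a) (BSide d b)])%E.
Proof.
set D := [set` _]; have mD : measurable (D : set (measurableTypeR R)) by exact: measurable_itv.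
have m : measurable_fun D (EFin \o u0) by apply/measurable_EFinP; exact: measurable_funTS.
have le : (\int[mu]_(x in D) `|(EFin \o u0) x| <= M%:E * mu D)%E.
  apply: integral_le_bound => //.
  by apply: (ae_imp u0M) => x H _; rewrite lee_fin.
split=> //; apply/integrableP; split=> //; apply: le_lt_trans le _.
by rewrite lte_mul_pinfty ?lee_fin//; exact: itv_bnd_lty.
Qed.

Lemma primitiveB x y : x <= y ->
  primitive u0 y - primitive u0 x = \int[mu]_(t in `]x, y]) u0 t.
Proof.
move=> xy; pose N := `|x| + `|y| + 1.
pose P z := \int[mu]_(t in `]- N, z]) u0 t.
have PB a b : - N <= a -> a <= b -> P b - P a = \int[mu]_(t in `]a, b]) u0 t.
  move=> Na ab; apply: Rintegral_itvB; rewrite ?bnd_simp//.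
  exact: (integral_bounded_itv false false _ _).1.
have N0 : 0 < N by rewrite ltr_wpDl// addr_ge0.
have PE z : - N <= z -> primitive u0 z = P z - P 0.
  move=> Nz; rewrite /primitive; case: ifPn => [z0|]; last rewrite -ltNge => /ltW z0.
    rewrite PB//; last by lra.
    rewrite Rintegral_itv_obnd_cbnd//; exact: (integral_bounded_itv false false _ _).1.
  rewrite -[RHS]opprB PB//.
  rewrite Rintegral_itv_obnd_cbnd//; exact: (integral_bounded_itv false false _ _).1.
have Nx : - N <= x by rewrite /N; have := ler_norm (- x); rewrite normrN; have := normr_ge0 y; lra.
rewrite !PE//; last exact: le_trans xy.
by rewrite -PB//; ring.
Qed.

Lemma primitive_lip : lip M (primitive u0).
Proof.
have side x y : x <= y -> `|primitive u0 y - primitive u0 x| <= M * `|y - x|.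
  move=> xy; rewrite primitiveB//.
  have [iu le] := integral_bounded_itv false false x y.
  have mD : measurable (`]x, y]%classic : set (measurableTypeR R)) by exact: measurable_itv.
  rewrite (le_trans (le_normr_Rintegral mD iu))//.
  rewrite -lee_fin fineK; last first.
    by apply: integrable_fin_num => //; exact: integrable_abse iu.
  apply: le_trans le _; rewrite lebesgue_measure_itv/= lte_fin.
  case: ltP => [|_]; last by rewrite mule0 lee_fin mulr_ge0.
  by rewrite -EFinB -EFinM lee_fin ger0_norm// subr_ge0.
move=> x y; have [xy|/ltW yx] := leP x y; last exact: side.
by rewrite distrC (distrC x) side.
Qed.

Lemma primitive_ae_derive1 : {ae mu, forall x, derive1 (primitive u0) x = u0 x}.
Proof.
have H n : {ae mu, forall x, - n%:R < x < n%:R -> derive1 (primitive u0) x = u0 x}.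
  have := @ae_derive_of_density _ (primitive u0) u0 n%:R (integral_bounded_itv false false _ _).1.
  move=> /(_ (fun x y _ xy _ => esym (primitiveB xy)))/ae_imp; apply=> x + xn.
  by move=> /(_ xn)[].
move/ae_foralln/ae_imp : H; apply=> x H.
apply: (H (Num.truncn `|x|).+1); rewrite -ltr_norml; exact: truncnS_gt.
Qed.

End Primitive.

(** * Maximal speed *)

Section MaxSpeed.
Context {R : realType}.
Local Notation mu := (@lebesgue_measure R).
Implicit Types (f g : R -> R) (p q x y r e c K : R).

Lemma subgrad_derive1 f x : convexR f -> derivable f x 1 -> subgrad f x (derive1 f x).
Proof.
move=> fc df; have [q fq] := subgrad_exists x fc.
suff -> : derive1 f x = q by [].
have hd : quotient f x h @[h --> 0^'] --> derive1 f x.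
  by rewrite derive1_quotient; exact/derivable_quotient.
have hp := cvg_comp _ _ harmonic_dnbhs hd; have hn := cvg_comp _ _ harmonicN_dnbhs hd.
have h0 n : 0 < harmonic n :> R by rewrite invr_gt0.
apply/eqP; rewrite eq_le; apply/andP; split.
  apply: (cvgr_to_le hn); apply: nearW => n.
  suff : quotient f x (- harmonic n) <= q by [].
  move: (h0 n) (fq (- harmonic n + x)); move: (harmonic n) => h hp0; rewrite addrK => H.
  by rewrite /quotient invrN mulNr -mulrN mulrC ler_pdivrMr//; lra.
apply: (cvgr_to_ge hp); apply: nearW => n.
suff : q <= quotient f x (harmonic n) by [].
move: (h0 n) (fq (harmonic n + x)); move: (harmonic n) => h hp0; rewrite addrK => H.
by rewrite /quotient mulrC ler_pdivlMr//; lra.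
Qed.

Lemma convex_ae_derivable f a b : convexR f ->
  {ae mu, forall x, a < x < b -> derivable f x 1}.
Proof.
move=> fc; pose M := `|a| + `|b|.
have [K K0 fK] := convex_locally_lipschitz M fc.
have M0 : 0 <= M by rewrite addr_ge0.
pose c x := Num.min M (Num.max (- M) x).
have cM x : - M <= c x <= M.
  by rewrite /c le_min ge_min lexx le_max lexx /= andbT; lra.
have c1 x y : x <= y -> 0 <= c y - c x <= y - x.
  move=> xy; have m1 : 0 <= Num.max (- M) y - Num.max (- M) x <= y - x.
    by case: (leP (- M) x) => h1; case: (leP (- M) y) => h2; lra.
  move: m1; rewrite /c; set my := Num.max _ y; set mx := Num.max _ x.
  by case: (leP M my) => h1; case: (leP M mx) => h2; lra.
have c1' x y : `|c x - c y| <= `|x - y|.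
  have [/c1|/ltW/c1] := leP x y => /andP[h1 h2]; last by rewrite !ger0_norm//; lra.
  by rewrite distrC (distrC x) !ger0_norm//; lra.
have lF : lip K (f \o c).
  by move=> x y /=; rewrite (le_trans (fK _ _ (cM _) (cM _)))// ler_wpM2l.
apply: (ae_imp (lip_ae_derivable lF)) => x dF /andP[ax xb].
apply: near_eq_derivable dF.
have Mx : x \in `]- M, M[.
  rewrite in_itv/= /M; have := ler_norm b; have := ler_norm (- a); rewrite normrN.
  have := normr_ge0 a; have := normr_ge0 b; lra.
apply: filterS (near_in_itvoo Mx) => y; rewrite in_itv/= => /andP[My yM] /=.
by rewrite /c max_r ?min_r ?(ltW My) ?(ltW yM).
Qed.

Lemma ae_mrestr_subset (D D' : set (measurableTypeR R)) (mD : measurable D)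
    (mD' : measurable D') (P : R -> Prop) : D `<=` D' ->
  {ae mrestr mu mD', forall x, P x} -> {ae mrestr mu mD, forall x, P x}.
Proof.
move=> DD' [A [mA A0 PA]]; exists A; split=> //.
apply/eqP; rewrite eq_le measure_ge0 andbT -A0 /mrestr.
by apply: le_measure; rewrite ?inE; [exact: measurableI|exact: measurableI|exact: setIS].
Qed.

Lemma ess_sup_derive1_ge f (D : set (measurableTypeR R)) (mD : measurable D) a b c :
  convexR f -> a < b -> `]a, b[ `<=` D ->
  (forall x, a < x < b -> derivable f x 1 -> c <= `|derive1 f x|) ->
  (c%:E <= ess_sup (mrestr mu mD) (fun x => `|derive1 f x|%:E))%E.
Proof.
move=> fc ab abD Hc; rewrite leNgt; apply/negP => lt_c.
have [A [mA A0 PA]] := ess_sup_ge (mrestr mu mD) (fun x => `|derive1 f x|%:E).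
have [B [mB B0 PB]] := convex_ae_derivable a b fc.
have mab : measurable (`]a, b[%classic : set (measurableTypeR R)) by exact: measurable_itv.
have : (mu `]a, b[%classic <= mu ((A `&` D) `|` B))%E.
  apply: le_measure; rewrite ?inE//; first by apply: measurableU => //; exact: measurableI.
  move=> x xab; have [dx|ndx] := pselect (derivable f x 1); [left|right].
    split; last exact: abD.
    apply: PA => /=; apply/negP; rewrite -ltNge (lt_le_trans lt_c)// lee_fin.
    by apply: Hc => //; move: xab; rewrite /= in_itv.
  by apply: PB => /= H; apply: ndx; apply: H; move: xab; rewrite /= in_itv.
rewrite leNgt => /negP; apply.
apply: (@le_lt_trans _ _ (mu (A `&` D) + mu B)%E).
  by apply: measureU2 => //; exact: measurableI.
have A0' : mu (A `&` D) = 0%E := A0.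
rewrite A0' B0 adde0.
by rewrite lebesgue_measure_itv/= lte_fin ab -EFinB lte_fin subr_gt0.
Qed.

Lemma max_speed_bound f g r : convexR f -> convexR g -> 0 <= r ->
  (forall p, - r - 1 <= p <= r + 1 -> g p = f p) -> speed_bound g r (max_speed f r).
Proof.
move=> fc gc r0 gf.
pose S e := ess_sup (mrestr mu (measurable_itv `[- r - e, r + e])) (fun p => `|derive1 f p|%:E).
have [K fK] := speed_bound_exists (r + 1) fc.
have S_nd e e' : e <= e' -> (S e <= S e')%E.
  move=> ee'; apply/ess_supP; apply: ae_mrestr_subset (ess_sup_ge _ _).
  by apply: subset_itv; rewrite bnd_simp; lra.
have Slim : S e @[e --> 0^'+] --> ereal_inf [set S e | e in `]0, 1[].
  apply: nondecreasing_at_right_cvge; first by rewrite bnd_simp.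
  by move=> e e' _ _; exact: S_nd.
have SK e : 0 < e < 1 -> (S e <= K%:E)%E.
  move=> e01; apply/ess_supP.
  exists (~` `[- r - e, r + e]); split.
  - by apply: measurableC; exact: measurable_itv.
  - have : mu (~` `[- r - e, r + e] `&` `[- r - e, r + e]%classic) = 0%E.
      by rewrite setICl measure0.
    exact.
  - move=> p /=; apply: contra_not => /=; rewrite in_itv/= => pre.
    rewrite lee_fin; have K0 : 0 <= K by apply: speed_bound_ge0 fK => //; lra.
    have [dp|ndp] := pselect (derivable f p 1); last by rewrite derive1_nondiff// normr0.
    by rewrite ler_norml; apply: fK (subgrad_derive1 fc dp); lra.
have qS p q e : - r <= p <= r -> subgrad g p q -> 0 < e < 1 -> (`|q|%:E <= S e)%E.
  move=> pr gq e01.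
  have gt x : r < x < r + e -> derivable f x 1 -> q <= derive1 f x.
    move=> xr dx; have := subgrad_derive1 fc dx p; have := gq x.
    rewrite !gf; [|lra|lra] => h1 h2.
    by rewrite -(@ler_pM2r _ (x - p)); lra.
  have lt x : - r - e < x < - r -> derivable f x 1 -> derive1 f x <= q.
    move=> xr dx; have := subgrad_derive1 fc dx p; have := gq x.
    rewrite !gf; [|lra|lra] => h1 h2.
    by rewrite -(@ler_pM2r _ (p - x)); lra.
  have [q0|/ltW q0] := leP 0 q.
    apply: (@ess_sup_derive1_ge _ _ _ r (r + e)) => //; first lra.
      by apply: subset_itv; rewrite bnd_simp; lra.
    by move=> x xr dx; rewrite ger0_norm// (le_trans (gt _ xr dx))// ler_norm.
  apply: (@ess_sup_derive1_ge _ _ _ (- r - e) (- r)) => //; first lra.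
    by apply: subset_itv; rewrite bnd_simp; lra.
  move=> x xr dx; have := lt _ xr dx => h.
  by rewrite ler0_norm// -normrN (le_trans _ (ler_norm _))// lerN2.
move=> p q pr gq; rewrite -ler_norml /max_speed (cvg_lim _ Slim)//.
have inf_le : (ereal_inf [set S e | e in `]0%R, 1%R[] <= K%:E)%E.
  apply: ge_ereal_inf; exists (S (1 / 2)); last by apply: SK; lra.
  by exists (1 / 2) => //=; rewrite in_itv/=; lra.
have inf_ge : (`|q|%:E <= ereal_inf [set S e | e in `]0%R, 1%R[])%E.
  apply: le_ereal_inf_tmp; move=> y [z]; rewrite /= in_itv/= => z01 <-.
  exact: qS pr gq z01.
rewrite -lee_fin fineK// fin_numElt (lt_le_trans _ inf_ge) ?ltNyr//=.
by rewrite (le_lt_trans inf_le)// ltry.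
Qed.

End MaxSpeed.

(** * The value function on the half plane *)

Section HalfPlane.
Context {R : realType}.
Local Notation mu := (@lebesgue_measure R).
Local Notation T2 := (measurableTypeR R * measurableTypeR R)%type.
Local Notation H := (open_half : set T2).
Implicit Types (x y t h k C : R).

Lemma measurable_lip_time (V : R -> R -> R) C : 0 <= C ->
  (forall t, 0 <= t -> continuous (V ^~ t)) ->
  (forall x t h, 0 <= t -> 0 <= h -> `|V x (t + h) - V x t| <= C * h) ->
  measurable_fun H (fun z => V z.1 z.2).
Proof.
move=> C0 cV tV.
pose d n t : R := (Num.truncn (n.+1%:R * t))%:R / n.+1%:R.
have n0 n : 0 < n.+1%:R :> R by rewrite ltr0n.
have truncP n t m : 0 <= t -> (Num.truncn (n.+1%:R * t) = m <->
    m%:R / n.+1%:R <= t < m.+1%:R / n.+1%:R).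
  move=> t0; rewrite ler_pdivrMr// ltr_pdivlMr// (mulrC t); split=> [<-|].
    exact: truncn_itv (mulr_ge0 (ltW (n0 n)) t0).
  exact: truncn_def.
have dP n t : 0 <= t -> d n t <= t < d n t + n.+1%:R^-1.
  move=> t0; have /andP[h1 h2] := (truncP n t _ t0).1 erefl.
  rewrite /d h1 /=; apply: lt_le_trans h2 _.
  by rewrite -[X in _ + X]mul1r -mulrDl natr1.
have d0 n t : 0 <= d n t by rewrite divr_ge0.
have mH : measurable H by exact: measurable_open_half.
apply: (@measurable_fun_cvg _ _ _ H (fun n z => V z.1 (d n z.2))) => [n|z zH].
  move=> _ Y mY.
  pose B m := `[m%:R / n.+1%:R, m.+1%:R / n.+1%:R[%classic : set (measurableTypeR R).
  have -> : H `&` (fun z : T2 => V z.1 (d n z.2)) @^-1` Y =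
      H `&` \bigcup_m (((fun x => V x (m%:R / n.+1%:R)) @^-1` Y) `*` B m).
    apply/seteqP; split=> [[x t] /= [zH Yz]|[x t] /= [zH [m _ [/= Yz Bt]]]];
      have t0 : 0 <= t by case: zH => _; rewrite /= in_itv/= andbT => /ltW.
      split=> //; exists (Num.truncn (n.+1%:R * t)) => //; split=> //.
      by rewrite /B/= in_itv/=; exact/truncP.
    split=> //; move: Bt; rewrite /B/= in_itv/= => /(truncP n t m t0) E.
    by rewrite /d E.
  apply: measurableI => //; apply: bigcup_measurable => m _; apply: measurableX.
    rewrite -[X in measurable X]setTI.
    by apply: (continuous_measurable_fun (cV (m%:R / n.+1%:R) _)) => //; rewrite divr_ge0.
  exact: measurable_itv.
have t0 : 0 <= z.2 by case: zH => _; rewrite /= in_itv/= andbT => /ltW.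
apply/cvgrPdist_le => e e0.
have e1 : 0 < e / (C + 1) by rewrite divr_gt0// ltr_wpDl.
have /cvgrPdist_lt/(_ _ e1) := @cvg_harmonic R.
apply: filterS => n; rewrite sub0r normrN => hn.
have /andP[h1 h2] := dP n z.2 t0; have {}h2 : z.2 < d n z.2 + harmonic n := h2.
have := tV z.1 (d n z.2) (z.2 - d n z.2) (d0 _ _); rewrite subr_ge0 => /(_ h1).
rewrite (addrC (d n z.2)) subrK => /le_trans; apply.
have hC : z.2 - d n z.2 <= e / (C + 1).
  by apply: ltW; apply: le_lt_trans hn; rewrite (le_trans _ (ler_norm _))//; lra.
rewrite (le_trans (ler_wpM2l C0 hC))// mulrCA ger_pMr// ler_pdivrMr ?ltr_wpDl// mul1r lerDl//.
Qed.

Lemma half_measure_negligible (P : T2 -> Prop) :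
  measurable (H `&` [set z | P z]) ->
  (forall t, 0 < t -> {ae mu, forall x, P (x, t)}) ->
  {ae half_measure, forall z, P z}.
Proof.
move=> mP aeP; have mH : measurable H by exact: measurable_open_half.
pose N := H `\` (H `&` [set z | P z]).
have mN : measurable N by exact: measurableD.
exists (N `|` ~` H); split.
- by apply: measurableU => //; exact: measurableC.
- have -> : half_measure (N `|` ~` H) = (mu \x mu)%E N.
    rewrite /half_measure /mrestr; congr ((mu \x mu)%E _).
    by rewrite setIUl setICl setU0 setIidl// => z [].
  rewrite (@product_measure_unique _ _ _ _ _ mu mu (mu \x^ mu)%E)//; last first.
    by move=> A B mA mB; exact: product_measure2E.
  rewrite /product_measure2; apply: integral0_eq => t _ /=.
  have mY : measurable (ysection N t) by exact: measurable_ysection.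
  have [t0|t0] := ltP 0 t; last first.
    rewrite (_ : ysection N t = set0) ?measure0//; apply/seteqP; split=> // x.
    rewrite ysectionE/= => -[[_ /=]]; rewrite in_itv/= andbT => t0'.
    by move: t0; rewrite leNgt t0'.
  have [A [mA A0 PA]] := aeP t t0.
  apply/eqP; rewrite eq_le measure_ge0 andbT -A0; apply: le_measure; rewrite ?inE//.
  move=> x; rewrite ysectionE/= => -[zH nP]; apply: PA => Px; apply: nP; split=> //.
- move=> z /= nPz; have [zH|nH] := pselect (H z); [left|by right].
  by split=> // -[_].
Qed.

End HalfPlane.

Section ValueFunction.
Context {R : realType}.
Local Notation mu := (@lebesgue_measure R).
Implicit Types (x y t s h k : R).
Variables (f g v : R -> R) (r : R).
Hypotheses (gc : convexR g) (gs : finite_conjugate g) (r0 : 0 <= r)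
  (gf : forall p, - r <= p <= r -> g p = f p) (vr : lip r v).

Local Notation V := (value g v).

Lemma value_nonpos x t : t <= 0 -> V x t = v x.
Proof. by rewrite /value leNgt => /negbTE ->. Qed.

Lemma value_lip k t : lip k v -> lip k (V ^~ t).
Proof.
move=> vk x y; have [t0|t0] := ltP 0 t; last by rewrite !value_nonpos.
have [L gL] := speed_bound_exists r gc.
by rewrite !value_hopf_lax ?(ltW t0)//; exact: (hopf_lax_lip gc gs r0 gL vr (ltW t0) vk).
Qed.

Lemma value_semigroup x s t : 0 <= s -> s <= t ->
  V x t = hopf_lax g (V ^~ s) (t - s) x.
Proof.
move=> s0 st; have [L gL] := speed_bound_exists r gc.
rewrite value_hopf_lax ?(le_trans s0)// (_ : V ^~ s = hopf_lax g v s); last first.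
  by apply/funext => y; rewrite value_hopf_lax.
by rewrite (hopf_lax_semigroup gc gs r0 gL x vr s0) ?subr_ge0// addrC subrK.
Qed.

Lemma value_time_lip : exists2 C, 0 <= C & forall x t h, 0 <= t -> 0 <= h ->
  `|V x (t + h) - V x t| <= C * h.
Proof.
have [L gL] := speed_bound_exists r gc.
have [C C0 HC] := hopf_lax_time_lip gc gs r0 gL; exists C => // x t h t0 h0.
by rewrite !value_hopf_lax// ?addr_ge0//; exact: HC.
Qed.

Lemma value_joint_lip : exists2 C, 0 <= C & forall x y s t,
  `|V x t - V y s| <= r * `|x - y| + C * `|t - s|.
Proof.
have [C C0 HC] := value_time_lip; exists C => // x y s t.
have time a b : a <= b -> `|V x b - V x a| <= C * `|b - a|.
  move=> ab; have [a0|/ltW a0] := leP 0 a.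
    by have := HC x a (b - a) a0; rewrite subr_ge0 (addrC a) subrK => /(_ ab); rewrite (ger0_norm (x := b - a)) ?subr_ge0.
  rewrite (value_nonpos _ a0); have [b0|/ltW b0] := leP b 0.
    by rewrite value_nonpos// subrr normr0 mulr_ge0.
  have := HC x 0 b (lexx _) b0; rewrite add0r (value_nonpos _ (lexx 0)) => /le_trans; apply.
  by rewrite ler_wpM2l// ger0_norm ?subr_ge0// lerDl oppr_ge0.
have {}time : `|V x t - V x s| <= C * `|t - s|.
  by have [st|/ltW ts] := leP s t; [exact: time|rewrite distrC (distrC t) time].
rewrite -(subrK (V x s) (V x t)) -addrA (le_trans (ler_normD _ _))// [leRHS]addrC lerD//.
exact: value_lip.
Qed.

Lemma value_lipschitz_closed_half : [lipschitz (V z.1 z.2) | z in closed_half].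
Proof.
have [C C0 HC] := value_joint_lip.
exists (r + C); split; first by rewrite num_real.
move=> M CM [z w] _ /=; apply: (@le_trans _ _ ((r + C) * `|z - w|)); last first.
  by rewrite ler_wpM2r// ltW.
rewrite (le_trans (HC _ _ _ _))// mulrDl lerD// ler_wpM2l//.
  by rewrite [leRHS]prod_normE/= le_max lexx.
by rewrite [leRHS]prod_normE/= le_max lexx orbT.
Qed.

Lemma value_continuous : continuous (fun z : R * R => V z.1 z.2).
Proof.
have [C C0 HC] := value_joint_lip => z; apply/cvgrPdist_le => e e0.
have d0 : 0 < e / (r + C + 1) by rewrite divr_gt0// ltr_wpDl// addr_ge0.
have : nbhs z [set w | `|V z.1 z.2 - V w.1 w.2| <= e]; last exact.
apply/nbhs_ballP; exists (e / (r + C + 1)) => // w [/= h1 h2].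
rewrite (le_trans (HC _ _ _ _))//.
apply: (@le_trans _ _ ((r + C + 1) * (e / (r + C + 1)))); last first.
  by rewrite mulrC divfK// gt_eqF// ltr_wpDl// addr_ge0.
have := ler_wpM2l r0 (ltW h1); have := ler_wpM2l C0 (ltW h2); lra.
Qed.

Lemma value_viscosity : viscosity_solution f v V.
Proof.
have [L gL] := speed_bound_exists r gc; have L0 := speed_bound_ge0 gc r0 gL.
have fg p : `|p| <= r -> f p = g p by rewrite ler_norml => /gf.
have Vr t : 0 <= t -> lip r (V ^~ t) by move=> _; exact: value_lip.
have Vle x t h q : 0 <= h -> h <= t -> V x t <= V (x - h * q) (t - h) + h * fenchel g q.
  move=> h0 ht; have th : 0 <= t - h by rewrite subr_ge0.
  rewrite (value_semigroup x th) ?gerBl// subKr.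
  exact: (hopf_lax_le gc gs r0 gL (Vr _ th) x q h0).
have Veq x t h : 0 <= h -> h <= t -> exists2 q, `|q| <= L &
     V x t = V (x - h * q) (t - h) + h * fenchel g q.
  move=> h0 ht; have th : 0 <= t - h by rewrite subr_ge0.
  have [q qL E] := hopf_lax_attained gc gs r0 gL (Vr _ th) x h0.
  by exists q; rewrite ?ler_norml// (value_semigroup x th) ?gerBl// subKr.
split.
- exact: continuous_subspaceT value_continuous.
- by move=> x; exact: value_nonpos.
- by move=> phi z; exact: (hopf_lax_subsolution gc gs fg Vr Vle).
- by move=> phi z; exact: (hopf_lax_supersolution gs L0 fg Vr Veq).
Qed.

Lemma value_right_derivative x t : 0 <= t -> derivable (V ^~ t) x 1 ->
  (V x (t + harmonic n) - V x t) / harmonic n @[n --> \oo] --> - f (derive1 (V ^~ t) x).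
Proof.
move=> t0 dV; have [L gL] := speed_bound_exists r gc.
have Vr := value_lip t vr.
have -> : (fun n => (V x (t + harmonic n) - V x t) / harmonic n) =
    (fun n => (hopf_lax g (V ^~ t) (harmonic n) x - V x t) / harmonic n).
  apply/funext => n; have h0 : 0 <= harmonic n :> R by rewrite invr_ge0.
  by rewrite (@value_semigroup x t (t + harmonic n)) ?lerDl// (addrC t) addrK.
rewrite -gf; first exact: (hopf_lax_right_derivative gc gs r0 gL Vr dV).
by rewrite -ler_norml; exact: lip_derive1_le.
Qed.

Lemma measurable_value_shift h : measurable_fun
  (open_half : set (measurableTypeR R * measurableTypeR R)) (fun z => V (h + z.1) z.2).
Proof.
have [C C0 HC] := value_time_lip.
apply: (@measurable_lip_time _ (fun x t => V (h + x) t) C) => // [t t0|x t s t0 s0]; last exact: HC.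
apply: (@lip_continuous _ r) => x y.
by have := value_lip t vr (h + x) (h + y); rewrite opprD addrACA subrr add0r.
Qed.

Lemma measurable_dx_value : measurable_fun
  (open_half : set (measurableTypeR R * measurableTypeR R)) (fun z => dx_value g v z.1 z.2).
Proof.
apply: (@measurable_lip_derive1 _ _ _ _ _ (fun z x => V x z.2) fst r) => //.
- exact: measurable_open_half.
- by move=> z; exact: value_lip.
- exact: measurable_value_shift.
Qed.

Lemma value_ae_derivable : {ae half_measure, forall z, derivable (V ^~ z.2) z.1 1}.
Proof.
apply: half_measure_negligible.
  apply: (@measurable_lip_derivable _ _ _ _ _ (fun z x => V x z.2) fst r) => //.
  - exact: measurable_open_half.
  - by move=> z; exact: value_lip.
  - exact: measurable_value_shift.
by move=> t t0; exact: lip_ae_derivable (value_lip t vr).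
Qed.

Lemma half_norm_dx_value : (half_norm (dx_value g v) <= r%:E)%E.
Proof.
rewrite /half_norm unlock/=; case: ifPn => // _.
apply/ess_supP; apply: aeW => z /=; rewrite lee_fin.
exact: lip_derive1_le (value_lip _ vr).
Qed.

End ValueFunction.

Section Assembly.
Context {R : realType}.
Local Notation mu := (@lebesgue_measure R).
Implicit Types (x y t : R) (f g v : R -> R).

Lemma modificationP f g r : modification f r g ->
  [/\ convexR g, finite_conjugate g & forall p, - r - 1 <= p <= r + 1 -> g p = f p].
Proof.
move=> [/convex_functionR gc gs gf]; split; [exact: gc|by move=> q; exact: superlinear_has_sup|].
by move=> p pr; apply: gf; rewrite in_itv.
Qed.

Lemma lip_Lip r v : lip r v -> exists2 k, Lip v = k%:E & lip k v.
Proof.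
move=> vr; have r0 := lip_ge0 vr.
have Lr : (Lip v <= r%:E)%E.
  apply: ge_ereal_sup => _ [x [y [xy ->]]].
  by rewrite lee_fin ler_pdivrMr ?normr_gt0 ?subr_eq0.
have Lxy x y : x != y -> ((`|v x - v y| / `|x - y|)%:E <= Lip v)%E.
  by move=> xy; apply: ereal_sup_ubound; exists x, y.
have Lf : Lip v \is a fin_num.
  rewrite fin_numElt (le_lt_trans Lr) ?ltry// andbT.
  by apply: lt_le_trans (Lxy 1 0 _); rewrite ?ltNyr ?oner_neq0.
exists (fine (Lip v)); first by rewrite fineK.
move=> x y; have [->|xy] := eqVneq x y; first by rewrite !subrr normr0 mulr0.
have := Lxy _ _ xy; rewrite -(fineK Lf) lee_fin ler_pdivrMr//.
by rewrite normr_gt0 subr_eq0.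
Qed.

Lemma Rintegral_support N (F : R -> R) : (forall x, N <= `|x| -> F x = 0) ->
  \int[mu]_x F x = \int[mu]_(x in `[- N, N]) F x.
Proof.
move=> F0; rewrite [RHS]Rintegral_mkcond; apply: eq_Rintegral => x _.
rewrite patchE; case: ifPn => // xN; apply: F0; rewrite leNgt; apply: contra xN => xN.
by rewrite inE/= in_itv/= -ler_norml ltW.
Qed.

Lemma value_weak_solution f g (u0 : R -> R) (r : R) : continuous f -> convexR g -> finite_conjugate g ->
  0 <= r -> (forall p, - r <= p <= r -> g p = f p) ->
  measurable_fun setT u0 -> {ae mu, forall x, `|u0 x| <= r} ->
  weak_solution f u0 (dx_value g (primitive u0)).
Proof.
move=> fc gc gs r0 gf mu0 u0r; have vr := primitive_lip mu0 r0 u0r.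
set v := primitive u0 in vr *; split.
  split; first exact: (measurable_dx_value gc gs r0 vr).
  exact: le_lt_trans (half_norm_dx_value gc gs r0 vr) (ltry _).
move=> phi /test_functionP[N [B [N0 B0 P]]].
have [C C0 VC] := value_time_lip gc gs r0 vr.
have Vr t (t0 : 0 <= t) : lip r (value g v ^~ t) by exact: (value_lip gc gs r0 vr).
have Vrd x t : 0 <= t -> derivable (value g v ^~ t) x 1 -> _ :=
  @value_right_derivative _ f g v r gc gs r0 gf vr x t.
have W := weak_identity Vr C0 VC Vrd fc N0 B0 P.
have -> : \int[mu]_(t in `]0, +oo[) (\int[mu]_x (dx_value g v x t * Dt phi (x, t) +
    f (dx_value g v x t) * Dx phi (x, t))) = moment (value g v) phi N 0.
  rewrite -W; apply: eq_Rintegral => t _; apply: Rintegral_support => x xN.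
  by rewrite (td_Dt0 P) ?(td_Dx0 P) ?mulr0 ?addr0//=; left.
rewrite (@Rintegral_support N); last by move=> x xN; rewrite (td_0 P) ?mulr0//=; left.
have psiL : lip B (fun x => phi (x, 0)).
  apply: lip_of_derivable => x; have [dx ->] := slice_x (@td_dx _ _ _ _ P (x, 0)).
  by split=> //; exact: (td_Dx P).
have dpsi x : derive1 (fun x => phi (x, 0)) x = Dx phi (x, 0).
  by have [] := slice_x (@td_dx _ _ _ _ P (x, 0)).
have psi0 x : N <= `|x| -> phi (x, 0) = 0 by move=> xN; rewrite (td_0 P)//=; left.
have := integral_lip_mul (ltW N0) vr psiL psi0.
have mI : measurable (`[- N, N]%classic : set (measurableTypeR R)) by exact: measurable_itv.
have mc (F : R -> R) k : lip k F -> measurable_fun (`[- N, N]%classic : set (measurableTypeR R)) F.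
  by move=> /lip_continuous Fc; apply: measurable_funTS; exact: continuous_measurable_fun.
pose A := `|v 0| + r * N.
have VA x : - N <= x <= N -> `|v x| <= A.
  rewrite -ler_norml => xN; rewrite -[v x](subrK (v 0)) (le_trans (ler_normD _ _))// addrC lerD2l.
  by rewrite (le_trans (vr _ _))// subr0 ler_wpM2l.
have PB x : - N <= x <= N -> `|phi (x, 0)| <= B * (N + N).
  rewrite -ler_norml => xN; have psiN : phi (N, 0) = 0 by rewrite psi0// (ger0_norm (ltW N0)).
  have := psiL x N; rewrite /= psiN subr0.
  move=> /le_trans; apply; rewrite ler_wpM2l// (le_trans (ler_normB _ _))// lerD//.
  by rewrite gtr0_norm.
have i1 : mu.-integrable `[- N, N] (EFin \o (fun x => derive1 v x * phi (x, 0))).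
  apply: (@bounded_integrable_itv _ _ _ _ (r * (B * (N + N)))).
    by apply: measurable_funM; [exact: lip_measurable_derive1 vr _|exact: mc psiL].
  by move=> x xN; rewrite normrM ler_pM ?PB//; exact: lip_derive1_le.
have i2 : mu.-integrable `[- N, N] (EFin \o (fun x => v x * derive1 (fun x => phi (x, 0)) x)).
  apply: (@bounded_integrable_itv _ _ _ _ (A * B)).
    by apply: measurable_funM; [exact: mc vr|exact: lip_measurable_derive1 psiL _].
  by move=> x xN; rewrite normrM ler_pM ?VA//; exact: lip_derive1_le.
rewrite (RintegralD mI i1 i2) => E.
have e2 : moment (value g v) phi N 0 =
    \int[mu]_(x in `[- N, N]) (v x * derive1 (fun x => phi (x, 0)) x).
  by apply: eq_Rintegral => x _; rewrite dpsi value_nonpos.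
have e1 : \int[mu]_(x in `[- N, N]) (u0 x * phi (x, 0)) =
    \int[mu]_(x in `[- N, N]) (derive1 v x * phi (x, 0)).
  rewrite /Rintegral; congr fine; apply: ae_eq_integral.
  - exact: mI.
  - apply/measurable_EFinP; apply: measurable_funM; last exact: mc psiL.
    exact: measurable_funTS.
  - apply/measurable_EFinP; apply: measurable_funM; last exact: mc psiL.
    exact: lip_measurable_derive1 vr _.
  - by apply: (ae_imp (primitive_ae_derive1 mu0 r0 u0r)) => x <- _.
rewrite e2 e1; exact: etrans (addrC _ _) E.
Qed.

Lemma value_contraction g (u1 u2 : R -> R) (r L t a b : R) : convexR g -> finite_conjugate g ->
  0 <= r -> speed_bound g r L ->
  measurable_fun setT u1 -> {ae mu, forall x, `|u1 x| <= r} ->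
  measurable_fun setT u2 -> {ae mu, forall x, `|u2 x| <= r} ->
  0 < t -> a < b ->
  (\int[mu]_(x in `[a, b])
     `|dx_value g (primitive u1) x t - dx_value g (primitive u2) x t|%:E
   <= \int[mu]_(x in `[(a - L * t)%R, (b + L * t)%R]) `|u1 x - u2 x|%:E)%E.
Proof.
move=> gc gs r0 gL m1 u1r m2 u2r t0 ab.
have l1 := primitive_lip m1 r0 u1r; have l2 := primitive_lip m2 r0 u2r.
pose w x := `|u1 x - u2 x|.
have mw : measurable_fun setT w by apply: measurableT_comp => //; exact: measurable_funB.
have rr0 : 0 <= r + r by rewrite addr_ge0.
have wr : {ae mu, forall x, `|w x| <= r + r}.
  apply: (ae_imp (ae_and u1r u2r)) => x [h1 h2].
  by rewrite /w normr_id (le_trans (ler_normB _ _))// lerD.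
have LG := primitive_lip mw rr0 wr.
have vG x y : x <= y -> `|(primitive u1 y - primitive u2 y) - (primitive u1 x - primitive u2 x)|
    <= primitive w y - primitive w x.
  move=> xy; rewrite (primitiveB mw rr0 wr xy).
  have -> : (primitive u1 y - primitive u2 y) - (primitive u1 x - primitive u2 x) =
      (primitive u1 y - primitive u1 x) - (primitive u2 y - primitive u2 x) by ring.
  rewrite (primitiveB m1 r0 u1r xy) (primitiveB m2 r0 u2r xy).
  have mD : measurable (`]x, y]%classic : set (measurableTypeR R)) by exact: measurable_itv.
  have i1 := (integral_bounded_itv m1 r0 u1r false false x y).1.
  have i2 := (integral_bounded_itv m2 r0 u2r false false x y).1.
  rewrite -RintegralB//; apply: le_normr_Rintegral => //.
  exact: (integrableB mD i1 i2).
have h := hopf_lax_contraction gc gs r0 gL l1 l2 vG t0 (ltW ab).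
have L0 := speed_bound_ge0 gc r0 gL.
have Lt0 : 0 <= L * t by rewrite mulr_ge0// ltW.
have ab' : a - L * t <= b + L * t by lra.
rewrite (primitiveB mw rr0 wr ab') in h.
have iw1 := (integral_bounded_itv mw rr0 wr false false (a - L * t) (b + L * t)).1.
have iw := (integral_bounded_itv mw rr0 wr true false (a - L * t) (b + L * t)).1.
rewrite Rintegral_itv_obnd_cbnd// in h.
have dE (u : R -> R) x : dx_value g (primitive u) x t = derive1 (hopf_lax g (primitive u) t) x.
  rewrite /dx_value; congr (derive1 _ x); apply/funext => y.
  by rewrite value_hopf_lax ?(ltW t0).
have mab : measurable (`[a, b]%classic : set (measurableTypeR R)) by exact: measurable_itv.
have H1 := hopf_lax_lip gc gs r0 gL l1 (ltW t0) l1.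
have H2 := hopf_lax_lip gc gs r0 gL l2 (ltW t0) l2.
have iL : mu.-integrable `[a, b] (EFin \o (fun x =>
    `|derive1 (hopf_lax g (primitive u1) t) x - derive1 (hopf_lax g (primitive u2) t) x|)).
  apply: (@bounded_integrable_itv _ _ _ _ (r + r)).
    apply: measurableT_comp => //; apply: measurable_funB.
      exact: lip_measurable_derive1 H1 _.
    exact: lip_measurable_derive1 H2 _.
  move=> x _; rewrite normr_id (le_trans (ler_normB _ _))// lerD//; exact: lip_derive1_le.
under eq_integral do rewrite !dE.
rewrite -[leLHS]fineK; last exact: (integrable_fin_num mab iL).
rewrite -[leRHS]fineK; last by apply: integrable_fin_num iw; exact: measurable_itv.
by rewrite lee_fin.
Qed.

End Assembly.

Theorem theorem1 (R : realType) (f : R -> R)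
    (hf : convex_function [set: R] f) :
  (forall (u0 : R -> R) (hu0 : u0 \in Lfun (@lebesgue_measure R) +oo%E)
      (ft : R -> R) (hft : modification f (fine (Linfty_norm u0)) ft),
    let v0 := primitive u0 in
    let V := value ft v0 in
    let u := dx_value ft v0 in
    [/\ [lipschitz (V z.1 z.2) | z in closed_half] /\
          (forall x y t : R, 0 < t ->
             (`|V x t - V y t|%:E <= Lip v0 * `|x - y|%:E)%E),
        forall x s t : R, 0 <= s -> s < t -> value_from ft v0 x s t = V x t,
        viscosity_solution f v0 V &
        [/\ {ae half_measure, forall z, derivable (V ^~ z.2) z.1 1},
            weak_solution f u0 u &
            (half_norm u <= Linfty_norm u0)%E]]) /\
  (forall (u10 u20 : R -> R)
      (hu10 : u10 \in Lfun (@lebesgue_measure R) +oo%E)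
      (hu20 : u20 \in Lfun (@lebesgue_measure R) +oo%E)
      (ft : R -> R),
    let r := Num.max (fine (Linfty_norm u10)) (fine (Linfty_norm u20)) in
    modification f r ft ->
    let u1 := dx_value ft (primitive u10) in
    let u2 := dx_value ft (primitive u20) in
    let L := max_speed f r in
    {ae (@lebesgue_measure R), forall t : R, 0 < t ->
      forall a b : R, a < b ->
        (\int[@lebesgue_measure R]_(x in `[a, b]) `|u1 x t - u2 x t|%:E
         <= \int[@lebesgue_measure R]_(x in `[(a - L * t)%R, (b + L * t)%R])
              `|u10 x - u20 x|%:E)%E}).
Proof.
have fc := convex_functionR hf; have f_cont := convex_continuous fc.
split=> [u0 hu0 ft hft v0 V u|u10 u20 hu10 hu20 ft r hft u1 u2 L].
  have [mu0 r0 rE u0r] := Linfty_normP hu0.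
  have [gc gs gf] := modificationP hft.
  set r := fine (Linfty_norm u0) in hft r0 rE u0r gf.
  have gf' p : - r <= p <= r -> ft p = f p by move=> pr; apply: gf; lra.
  have vr : lip r v0 := primitive_lip mu0 r0 u0r.
  split.
  - split; first exact: (value_lipschitz_closed_half gc gs r0 vr).
    move=> x y t _; have [k -> vk] := lip_Lip vr.
    rewrite -EFinM lee_fin; exact: (value_lip gc gs r0 vr t vk).
  - move=> x s t s0 st; rewrite value_from_hopf_lax//.
    by rewrite -(value_semigroup gc gs r0 vr x s0 (ltW st)).
  - exact: (value_viscosity gc gs r0 gf' vr).
  - split.
    + exact: (value_ae_derivable gc gs r0 vr).
    + exact: (value_weak_solution f_cont gc gs r0 gf' mu0 u0r).
    + rewrite rE; exact: (half_norm_dx_value gc gs r0 vr).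
have [m1 r10 _ u1r] := Linfty_normP hu10.
have [m2 r20 _ u2r] := Linfty_normP hu20.
have [gc gs gf] := modificationP hft.
have r0 : 0 <= r by rewrite le_max r10.
have {}u1r : {ae (@lebesgue_measure R), forall x, `|u10 x| <= r}.
  by apply: (ae_imp u1r) => x h; rewrite le_max h.
have {}u2r : {ae (@lebesgue_measure R), forall x, `|u20 x| <= r}.
  by apply: (ae_imp u2r) => x h; rewrite le_max h orbT.
have gL : speed_bound ft r L := max_speed_bound fc gc r0 gf.
by apply: aeW => t t0 a b ab; exact: (value_contraction gc gs r0 gL m1 u1r m2 u2r t0 ab).
Qed.
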